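(* Let $R=k[x_1,\ldots,x_n]$ be a polynomial ring over a field $k$ and let $I\subset R$ be a nonzero proper monomial ideal. With the notation $\mathcal F(I)$, $Y$, $Y_i$, $K$, $K_i$, $\mathfrak q_{i\ell}$, $P_{i\ell}$, $Q_{i\ell}$ defined in the context: (a) The minimal prime ideals of $\mathcal F(I)$ are the minimal elements (with respect to inclusion) of the set $\{P_{i\ell}\}$. (b) $K=\bigcap_i(K_i,\,Y\setminus Y_i)=\bigcap_{i,\ell}(\mathfrak q_{i\ell},\,Y\setminus Y_i)=\bigcap_{i,\ell}Q_{i\ell}$, as ideals of $k[Y]$.
   Context: Let $\mathfrak m=(x_1,\ldots,x_n)$. For an ideal $J$ of $R$, $\mathcal R(J)=R[Jt]\subset R[t]$ is its Rees ring and $\mathcal F(J)=\mathcal R(J)\otimes_RR/\mathfrak m=\bigoplus_{j\ge0}J^j/\mathfrak mJ^j$ its special fiber ring. Let $v_1,\ldots,v_s$ be the Rees valuations of $I$, i.e. the normalized valuations of the discrete valuation rings $\overline{\mathcal R}_{\mathfrak Q}$, where $\overline{\mathcal R}=\bigoplus_{j\ge0}\overline{I^j}t^j$ is the integral closure of $\mathcal R(I)$ and $\mathfrak Q$ ranges over the minimal primes of $I\overline{\mathcal R}$. They correspond to the non-coordinate supporting hyperplanes of the facets of the Newton polyhedron of $I$: a hyperplane $\ell_1z_1+\cdots+\ell_nz_n=M$ with nonnegative integers $\ell_j,M$ and $\gcd(\ell_1,\ldots,\ell_n,M)=1$ gives the monomial valuation with $v(x_j)=\ell_j$ and $v(I)=M$.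 Set $d_i=v_i(I)=\min\{v_i(f):f\in I\}$, and let $I_i$ be the monomial ideal generated by all monomials $\alpha\in I$ with $v_i(\alpha)=d_i$. Let $\mathcal G=\{\alpha_j\}$ be the set of minimal monomial generators of $I$ and $\mathcal G_i=\{\alpha_j\in\mathcal G: v_i(\alpha_j)=d_i\}$, which is the set of minimal monomial generators of $I_i$. Let $Y=\{y_j:\alpha_j\in\mathcal G\}$ be a set of variables and $Y_i=\{y_j:\alpha_j\in\mathcal G_i\}$. The inclusion $I_i\subset I$ induces an injective homomorphism $\varphi_i:\mathcal F(I_i)\to\mathcal F(I)$. Let $L_i=(\alpha_j+\mathfrak mI:\alpha_j\in\mathcal G\setminus\mathcal G_i)\,\mathcal F(I)$. Let $\pi:k[Y]\to\mathcal F(I)/\sqrt0$ and $\pi_i:k[Y_i]\to\mathcal F(I_i)/\sqrt0$ be the surjections sending $y_j$ to the class of $\alpha_j+\mathfrak mI$, respectively $\alpha_j+\mathfrak mI_i$; put $K=\ker\pi$ and $K_i=\ker\pi_i$. For each $i$, let $\mathfrak p_{i\ell}$ be the minimal primes of $\mathcal F(I_i)$ and let $\mathfrak q_{i\ell}=\pi_i^{-1}(\mathfrak p_{i\ell})\subset k[Y_i]$ be their preimages. Let $P_{i\ell}=(\mathfrak p_{i\ell},L_i)\mathcal F(I)$ (with $\mathfrak p_{i\ell}$ viewed in $\mathcal F(I)$ via $\varphi_i$) and let $Q_{i\ell}=\pi^{-1}(P_{i\ell})\subset k[Y]$ be its preimage. (In forming preimages, primes of a special fiber ring are identified with their images modulo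 the nilradical $\sqrt0$.) For an ideal $\mathfrak a\subset k[Y_i]$, $(\mathfrak a,Y\setminus Y_i)$ denotes the ideal of $k[Y]$ generated by $\mathfrak a$ and the variables in $Y\setminus Y_i$. *)

(* Defs.v *)
From HB Require Import structures.
From mathcomp Require Import all_boot all_order all_algebra.
From mathcomp Require Import generic_quotient ring_quotient fraction.
From mathcomp Require Import mpoly.
From mathcomp Require Import boolp classical_sets functions cardinality.

Set Implicit Arguments.
Unset Strict Implicit.
Unset Printing Implicit Defensive.

Import Order.TTheory GRing.Theory Num.Theory.
Local Open Scope classical_set_scope.
Local Open Scope ring_scope.
Local Open Scope quotient_scope.

Section Ideals.
Variable A : comNzRingType.
Implicit Types (a b P : set A).

Definition is_ideal a : Prop :=
  [/\ a 0, forall x y, a x -> a y -> a (x + y) & forall c x, a x -> a (c * x)].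

Definition ideal_gen (X : set A) : set A := smallest is_ideal X.

Definition ideal_mul a b : set A :=
  ideal_gen [set z | exists x y, [/\ a x, b y & z = x * y]].

Definition ideal_exp a (j : nat) : set A := iter j (ideal_mul a) setT.

Definition prime_ideal P : Prop :=
  [/\ is_ideal P, ~ P 1 & forall x y, P (x * y) -> P x \/ P y].

Lemma ideal_gen_ideal X : is_ideal (ideal_gen X).
Proof.
split=> [B [[]]//|x y hx hy B hB|c x hx B hB].
- by case: (hB) => [[_ D _] _]; apply: D; [apply: hx|apply: hy].
- by case: (hB) => [[_ _ M] _]; apply: M; apply: hx.
Qed.

Lemma sub_ideal_gen X : X `<=` ideal_gen X.
Proof. exact: sub_smallest. Qed.

Lemma ideal_gen_min X a : is_ideal a -> X `<=` a -> ideal_gen X `<=` a.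
Proof. by move=> ida Xa x; apply. Qed.

Lemma ideal_opp a x : is_ideal a -> a x -> a (- x).
Proof. by case=> _ _ M ax; rewrite -mulN1r; apply: M. Qed.

Lemma ideal_sum a (I : Type) (r : seq I) (Q : pred I) (F : I -> A) :
  is_ideal a -> (forall i, Q i -> a (F i)) -> a (\sum_(i <- r | Q i) F i).
Proof. by case=> a0 aD _ aF; elim/big_ind: _. Qed.

Lemma ideal_mul_mem a b x y : a x -> b y -> ideal_mul a b (x * y).
Proof. by move=> ax bY; apply: sub_ideal_gen; exists x, y. Qed.

Lemma ideal_expS a j : ideal_exp a j.+1 = ideal_mul a (ideal_exp a j).
Proof. by []. Qed.

Lemma ideal_exp_ideal a j : is_ideal (ideal_exp a j).
Proof. by case: j => [|j]; [split|apply: ideal_gen_ideal]. Qed.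

Lemma ideal_exp_mem0 a j : ideal_exp a j 0.
Proof. by case: (ideal_exp_ideal a j). Qed.

Lemma ideal_expM a i j x y :
  ideal_exp a i x -> ideal_exp a j y -> ideal_exp a (i + j) (x * y).
Proof.
elim: i x y => [|i IH] x y.
  by move=> _ ay; case: (ideal_exp_ideal a j) => _ _; apply.
rewrite ideal_expS addSn => ax ay; move: x ax.
have [h0 hD hM] := ideal_exp_ideal a (i + j).+1.
apply: (ideal_gen_min (a := [set x | _])) => [|_ [u [v [au av ->]]]] /=.
  split=> /= [|u v|c u]; first by rewrite mul0r.
    by rewrite mulrDl; apply: hD.
  by rewrite -mulrA; apply: hM.
by rewrite -mulrA; apply: ideal_mul_mem => //; apply: IH.
Qed.

Lemma ideal_exp_exp a i j : ideal_exp (ideal_exp a i) j = ideal_exp a (i * j).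
Proof.
elim: j => [|j IH]; first by rewrite muln0.
apply/seteqP; split.
  apply: ideal_gen_min; first exact: ideal_exp_ideal.
  by move=> _ [u [v [au av ->]]]; rewrite mulnS; apply: ideal_expM; rewrite -?IH.
rewrite mulnS ideal_expS IH; set b := ideal_exp a (i * j).
have key m : ideal_exp a (m + i * j) `<=` ideal_mul (ideal_exp a m) b.
  elim: m => [|m IHm].
    by move=> x bx; rewrite -[x]mul1r; apply: ideal_mul_mem.
  apply: ideal_gen_min; first exact: ideal_gen_ideal.
  move=> _ [u [v [au av ->]]]; move: v {av}(IHm v av).
  have [h0 hD hM] := ideal_gen_ideal
    [set z | exists x y, [/\ ideal_exp a m.+1 x, b y & z = x * y]].
  apply: (ideal_gen_min (a := [set v | _])) => [|_ [w [z [aw bz ->]]]] /=.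
    split=> /= [|v w|c v]; first by rewrite mulr0.
      by rewrite mulrDr; apply: hD.
    by rewrite mulrCA; apply: hM.
  by rewrite mulrA; apply: ideal_mul_mem => //; apply: ideal_mul_mem.
exact: key.
Qed.

Lemma ideal_exp_sub a b j : a `<=` b -> ideal_exp a j `<=` ideal_exp b j.
Proof.
move=> ab; elim: j => // j IH; apply: ideal_gen_min; first exact: ideal_gen_ideal.
by move=> _ [x [y [ax ay ->]]]; apply: ideal_mul_mem; [apply: ab|apply: IH].
Qed.

End Ideals.

Definition minimal_elements {T : Type} (C : set (set T)) : set (set T) :=
  [set M | C M /\ forall N, C N -> N `<=` M -> N = M].

(* the primes minimal among those containing a *)
Definition minimal_primes (A : comNzRingType) (a : set A) : set (set A) :=
  minimal_elements [set P | prime_ideal P /\ a `<=` P].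

(* The Rees ring R[Jt] = (+)_j J^j t^j, as a subring of R[t]. *)
Section Rees.
Variables (R : comNzRingType) (J : set R).

Definition in_rees : {pred {poly R}} :=
  fun p : {poly R} => `[< forall j, ideal_exp J j p`_j >].

Lemma in_reesP (p : {poly R}) : reflect (forall j, ideal_exp J j p`_j) (p \in in_rees).
Proof. exact: asboolP. Qed.

Lemma in_rees_subring : GRing.subring_closed in_rees.
Proof.
split=> [|p q /in_reesP hp /in_reesP hq|p q /in_reesP hp /in_reesP hq];
    apply/in_reesP => j.
- by rewrite coef1; case: j => // j; apply: ideal_exp_mem0.
- rewrite coefB; have idJ := ideal_exp_ideal J j; case: (idJ) => _ D _.
  by apply: D => //; apply: ideal_opp.
- rewrite coefM; apply: ideal_sum; first exact: ideal_exp_ideal.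
  move=> i _; rewrite -{1}(subnKC (n := j) (m := i)); last by rewrite -ltnS.
  exact: ideal_expM.
Qed.
HB.instance Definition _ :=
  GRing.isSubringClosed.Build {poly R} in_rees in_rees_subring.

Record rees := Rees { rees_val : {poly R}; _ : rees_val \in in_rees }.
HB.instance Definition _ := [isSub for rees_val].
HB.instance Definition _ := [Choice of rees by <:].
HB.instance Definition _ := [SubChoice_isSubComNzRing of rees by <:].

Definition to_rees (p : {poly R}) : rees := insubd 0 p.

Lemma to_reesK p : p \in in_rees -> \val (to_rees p) = p.
Proof. exact: insubdK. Qed.

Lemma rees_const_mem (c : R) : c%:P \in in_rees.
Proof.
apply/in_reesP => -[|j] //; rewrite coefC; exact: ideal_exp_mem0.
Qed.

Lemma rees_deg1_mem (f : R) : J f -> f *: 'X \in in_rees.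
Proof.
move=> Jf; apply/in_reesP => -[|[|j]] //; rewrite coefZ coefX ?mulr1 ?mulr0.
  by rewrite -[f]mulr1; apply: ideal_mul_mem.
exact: ideal_exp_mem0.
Qed.

End Rees.

(* Integral closure of an ideal: roots of X^m + c_1 X^(m-1) + ... + c_m with
   c_i in J^i. (The case m = 0 is 1 = 0, hence excluded.) *)
Definition ideal_closure (R : comNzRingType) (J : set R) : set R :=
  [set f | exists (m : nat) (c : nat -> R),
     (forall i, ideal_exp J i (c i)) /\
     f ^+ m + \sum_(1 <= i < m.+1) c i * f ^+ (m - i) = 0].

(* The ring (+)_j closure(J^j) t^j; over a normal domain R it is the integral
   closure of R[Jt] in its field of fractions (J nonzero). *)
Section ReesClosure.
Variables (R : comNzRingType) (J : set R).

Lemma ideal_closureP (a : nat) (f : R) :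
  ideal_closure (ideal_exp J a) f <->
  integralOver (\val : rees J -> {poly R}) (f *: 'X^a).
Proof.
have [g gE] : exists g : {rmorphism rees J -> {poly R}}, (\val : _ -> _) = g.
  by exists \val.
have gV u : g u = \val u by rewrite -gE.
rewrite gE; have revE m (F : nat -> R) :
    \sum_(1 <= i < m.+1) F i = \sum_(k < m) F (m - k)%N.
  rewrite big_add1 /= big_mkord (reindex_inj rev_ord_inj) /=.
  by apply: eq_bigr => k _; rewrite subnSK.
have XcM (c d : R) i j : (c *: 'X^i) * (d *: 'X^j) = (c * d) *: 'X^(i + j).
  by rewrite -scalerAl -scalerAr scalerA -exprD.
have XcX (c : R) i j : (c *: 'X^i) ^+ j = (c ^+ j) *: 'X^(i * j).
  by rewrite exprZn -exprM.
split.
- move=> [m [c [cJ e]]].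
  have {}e : f ^+ m + \sum_(k < m) c (m - k)%N * f ^+ k = 0.
    rewrite -[RHS]e revE; congr (_ + _); apply: eq_bigr => k _.
    by rewrite subKn // ltnW.
  have cin i : c i *: 'X^(a * i) \in in_rees J.
    apply/in_reesP => j; rewrite coefZ coefXn; case: eqP => [->|_].
      by rewrite mulr1 -ideal_exp_exp.
    by rewrite mulr0; apply: ideal_exp_mem0.
  pose d k := to_rees J (c (m - k)%N *: 'X^(a * (m - k))).
  exists ('X^m + \poly_(k < m) d k).
    rewrite monicE lead_coefDl ?lead_coefXn //.
    by rewrite size_polyXn ltnS; apply: size_poly.
  rewrite /root rmorphD /= map_polyXn hornerD hornerXn; apply/eqP.
  have -> : map_poly g (\poly_(k < m) d k) = \poly_(k < m) g (d k).
    apply/polyP => k; rewrite coef_map !coef_poly.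
    by case: ifP => // _; apply: (rmorph0 g).
  rewrite horner_poly XcX.
  rewrite (eq_bigr (fun k : 'I_m => (c (m - k)%N * f ^+ k) *: 'X^(a * m))).
    by rewrite -scaler_suml -scalerDl e scale0r.
  move=> k _; rewrite gV /d to_reesK // XcX XcM -mulnDr subnK //.
  exact: ltnW.
- move=> [q q_mon /eqP q0].
  have sq : size q = (size q).-1.+1.
    by rewrite prednK // lt0n size_poly_eq0 monic_neq0.
  have q0' : g (lead_coef q) != 0 by rewrite (monicP q_mon) rmorph1 oner_eq0.
  move: q0; rewrite horner_coef size_map_poly_id0 //.
  set m := (size q).-1 in sq; rewrite sq => /(congr1 (coefp (a * m))).
  rewrite /= coef_sum coef0 big_ord_recr /= => e.
  exists m, (fun i => (\val q`_(m - i)) `_(a * i)); split.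
    move=> i; rewrite ideal_exp_exp; case: (q`_(m - i)) => p /= /in_reesP; exact.
  rewrite revE addrC -[RHS]e; congr (_ + _).
    apply: eq_bigr => k _; have km := ltnW (ltn_ord k).
    rewrite subKn // coef_map /= gV XcX -scalerAr coefZ coefMXn.
    by rewrite ltnNge leq_mul2l km orbT /= mulnBr mulrC.
  rewrite coef_map /= gV XcX -scalerAr coefZ coefMXn ltnn subnn /=.
  have -> : q`_m = 1 by move/monicP: q_mon; rewrite lead_coefE.
  by rewrite coef1 mulr1.
Qed.

Definition in_closure : {pred {poly R}} :=
  fun p : {poly R} => `[< forall j, ideal_closure (ideal_exp J j) p`_j >].

Lemma in_closureP (p : {poly R}) :
  reflect (forall j, ideal_closure (ideal_exp J j) p`_j) (p \in in_closure).
Proof. exact: asboolP. Qed.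

Lemma in_closure_subring : GRing.subring_closed in_closure.
Proof.
have c0 j : ideal_closure (ideal_exp J j) 0.
  by apply/ideal_closureP; rewrite scale0r; apply: integral0.
split=> [|p q /in_closureP hp /in_closureP hq
         |p q /in_closureP hp /in_closureP hq]; apply/in_closureP => j; apply/ideal_closureP.
- rewrite coef1; case: j => [|j]; last by rewrite scale0r; apply: integral0.
  by rewrite scale1r; apply: integral1.
- by rewrite coefB scalerBl; apply: integral_sub; apply/ideal_closureP.
- rewrite coefM scaler_suml; elim/big_ind: _ => [|u v|i _].
  + exact: integral0.
  + exact: integral_add.
  have -> : (p`_i * q`_(j - i)) *: 'X^j =
      (p`_i *: 'X^i) * (q`_(j - i) *: 'X^(j - i)).
    by rewrite -scalerAl -scalerAr scalerA -exprD subnKC // -ltnS.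
  by apply: integral_mul; apply/ideal_closureP.
Qed.
HB.instance Definition _ :=
  GRing.isSubringClosed.Build {poly R} in_closure in_closure_subring.

Record rees_closure :=
  ReesClosure { closure_val : {poly R}; _ : closure_val \in in_closure }.
HB.instance Definition _ := [isSub for closure_val].
HB.instance Definition _ := [Choice of rees_closure by <:].
HB.instance Definition _ := [SubChoice_isSubComNzRing of rees_closure by <:].

End ReesClosure.

(* Normalized (surjective onto int) discrete valuations of a field. The value
   v 0, morally +oo, is replaced by the dummy 0. *)
Definition normalized_valuation (K : fieldType) (v : K -> int) : Prop :=
  [/\ v 0 = 0,
      forall x y, x != 0 -> y != 0 -> v (x * y) = v x + v y,
      forall x y, x != 0 -> y != 0 -> x + y != 0 ->
        Num.min (v x) (v y) <= v (x + y)
    & exists2 x, x != 0 & v x = 1].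

Definition valuation_ring (K : fieldType) (v : K -> int) : set K :=
  [set z | z = 0 \/ 0 <= v z].

Section Reduced.
Variable A : comNzRingType.

Definition in_nilradical : {pred A} := fun x : A => `[< exists N, x ^+ N = 0 >].

Lemma nilradical_ideal : idealr_closed in_nilradical.
Proof.
split=> [||c x y /asboolP[N xN] /asboolP[M yM]].
- by apply/asboolP; exists 1; rewrite expr1.
- by apply/asboolP => -[N]; rewrite expr1n => /eqP; rewrite oner_eq0.
apply/asboolP; exists (N + M)%N; rewrite exprDn big1 // => i _.
have [le_iM|lt_Mi] := leqP i M.
  by rewrite -addnBA // exprMn [x ^+ _]exprD xN mul0r mulr0 mul0r mul0rn.
by rewrite -(subnKC (ltnW lt_Mi)) exprD yM mul0r mulr0 mul0rn.
Qed.
HB.instance Definition _ := isIdealr.Build A in_nilradical nilradical_ideal.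

(* A / sqrt 0 *)
Definition reduced := {ideal_quot in_nilradical}.
HB.instance Definition _ := GRing.ComNzRing.on reduced.
HB.instance Definition _ := Quotient.on reduced.

Definition to_reduced (x : A) : reduced := \pi_reduced x.

End Reduced.

Section Dickson.
Variable n : nat.

Lemma monotone_subseq (u : nat -> nat) :
  exists g : nat -> nat, {homo g : i j / (i < j)%N} /\
    {homo (u \o g) : i j / (i <= j)%N}.
Proof.
have /choice[h hP] : forall N, exists m, (N <= m)%N /\
    forall l, (N <= l)%N -> (u m <= u l)%N.
  move=> N; pose P d := `[< exists2 m, (N <= m)%N & u m = d >].
  have exP : exists d, P d by exists (u N); apply/asboolP; exists N.
  case: (ex_minnP exP) => d /asboolP[m Nm <-] dmin; exists m; split=> // l Nl.
  by apply: dmin; apply/asboolP; exists l.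
pose g i := iter i (fun m => h m.+1) (h 0).
have gS i : (g i < g i.+1)%N by have [] := hP (g i).+1.
exists g; split; first by apply: homo_ltn => //; apply: ltn_trans.
apply: homo_leq => // [|i /=]; first exact: leq_trans.
case: i => [|i]; first by have [_] := hP 0; apply.
have [_] := hP (g i).+1; apply.
exact: leq_trans (gS i) (ltnW (gS i.+1)).
Qed.

Lemma dickson (F : nat -> 'X_{1..n}) : exists i j, (i < j)%N /\ (F i <= F j)%MM.
Proof.
suff [g [g_incr gP]] : exists g : nat -> nat, {homo g : i j / (i < j)%N} /\
    forall l, l \in enum 'I_n -> {homo (fun i => F (g i) l) : i j / (i <= j)%N}.
  exists (g 0), (g 1); split; first exact: g_incr.
  by apply/mnm_lepP => l; apply: gP; rewrite ?mem_enum.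
elim: (enum 'I_n) => [|l s [g [g_incr gP]]]; first by exists id; split=> // l; rewrite in_nil.
have [h [h_incr hP]] := monotone_subseq (fun i => F (g i) l).
exists (g \o h); split=> [i j ij|l']; first exact/g_incr/h_incr.
rewrite inE => /predU1P[-> //|/gP gl'] i j ij; apply: gl'.
by move: ij; rewrite leq_eqVlt => /predU1P[->//|/h_incr/ltnW].
Qed.

(* Every antichain of monomials is finite. *)
Lemma antichain_finite (M : set 'X_{1..n}) :
  (forall a b, M a -> M b -> (a <= b)%MM -> a = b) -> finite_set M.
Proof.
move=> antiM; apply: contrapT => /infiniteP/card_leP[f].
pose F i := val (f (exist _ i (mem_set I) : [set: nat])).
have [i [j [lt_ij]]] := dickson F.
move=> /antiM eij; have /val_inj/(@inj _ _ _ f) : F i = F j.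
  by apply: eij; apply: set_mem; apply: valP.
move=> /(_ (mem_set I) (mem_set I))/(congr1 val) /= eq_ij.
by move: lt_ij; rewrite eq_ij ltnn.
Qed.

End Dickson.

Unset Implicit Arguments.

Section MonomialIdeals.
Context {k : fieldType} {n : nat}.
Local Notation S := {mpoly k[n]}.
Implicit Types (I J : set S) (v : {fraction {poly S}} -> int).

Definition monomial_ideal I : Prop :=
  exists M : set 'X_{1..n}, I = ideal_gen [set 'X_[k, a] | a in M].

Definition min_monomials I : set 'X_{1..n} :=
  [set a | I 'X_[a] /\ forall b, I 'X_[b] -> (b <= a)%MM -> b = a].

Lemma min_monomials_finite I :
  exists s : seq 'X_{1..n}, uniq s /\
    forall a, (a \in s) = `[< min_monomials I a >].
Proof.
have /finite_seqP[s Es] : finite_set (min_monomials I).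
  by apply: antichain_finite => a b [Ia _] [_ hb] /(hb _ Ia).
exists (undup s); split=> [|a]; first exact: undup_uniq.
by rewrite mem_undup Es; apply/idP/asboolP.
Qed.

(* An enumeration of the set G of minimal monomial generators of I; the
   variables y_j are those of {mpoly k[ngens I]}. *)
Definition gens I : seq 'X_{1..n} := sval (cid (min_monomials_finite I)).

Lemma gens_uniq I : uniq (gens I).
Proof. by rewrite /gens; case: cid => s [? ?]. Qed.

Lemma mem_gens I a : (a \in gens I) = `[< min_monomials I a >].
Proof. by rewrite /gens; case: cid => s [? ?]. Qed.

Definition ngens I : nat := size (gens I).
Definition gen I (j : 'I_(ngens I)) : 'X_{1..n} := nth 0%MM (gens I) j.

(* The special fiber ring F(J) = R[Jt] / m R[Jt]. *)
Section Fiber.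
Variable J : set S.

Definition irrelevant : set (rees J) :=
  ideal_gen (range (fun i : 'I_n => to_rees J ('X_i)%:P)).

Definition in_irrelevant : {pred rees J} := fun r : rees J => `[< irrelevant r >].

Lemma irrelevant_ideal : idealr_closed in_irrelevant.
Proof.
have [h0 hD hM] : is_ideal irrelevant by apply: ideal_gen_ideal.
split; first exact/asboolP.
  apply/asboolP => h1.
  pose C := [set r : rees J | ((\val r)`_0)@_0%MM = 0].
  have /(_ _ h1) : irrelevant `<=` C.
    apply: ideal_gen_min => [|_ [i _ <-]]; rewrite /C /=.
      split=> /= [|x y hx hy|c x hx].
      + by rewrite coef0 mcoeff0.
      + by rewrite coefD mcoeffD hx hy addr0.
      + by rewrite coef0M rmorphM /= hx mulr0.
    rewrite to_reesK ?rees_const_mem // coefC eqxx mcoeffX.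
    by case: eqP => // /mnmP/(_ i); rewrite mnm1E eqxx mnm0E.
  by rewrite /C /= coef1 mcoeff1 eqxx => /eqP; rewrite oner_eq0.
by move=> c x y /asboolP hx /asboolP hy; apply/asboolP; apply: hD => //; apply: hM.
Qed.
HB.instance Definition _ := isIdealr.Build (rees J) in_irrelevant irrelevant_ideal.

Definition fiber := {ideal_quot in_irrelevant}.
HB.instance Definition _ := GRing.ComNzRing.on fiber.
HB.instance Definition _ := Quotient.on fiber.

Definition fiber_const (c : k) : fiber := \pi_fiber (to_rees J (c%:MP)%:P).

(* the class f + mJ in the degree one part J / mJ, for f in J *)
Definition fiber_class (f : S) : fiber := \pi_fiber (to_rees J (f *: 'X)).

(* the k-algebra map k[y_1, ..., y_m] -> F(J) / sqrt 0, y_j |-> a_j + mJ *)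
Definition presentation (m : nat) (a : 'I_m -> 'X_{1..n}) :
    {mpoly k[m]} -> reduced fiber :=
  mmap (fun c => to_reduced (fiber_const c))
       (fun j => to_reduced (fiber_class 'X_[a j])).

End Fiber.

(* F(J) -> F(J') induced by an inclusion of J in J' *)
Definition fiber_incl J J' (z : fiber J) : fiber J' :=
  \pi_(fiber J') (to_rees J' (\val (repr z))).

Lemma fiber_inclE J J' (r : rees J) : J `<=` J' ->
  fiber_incl J J' (\pi_(fiber J) r) = \pi_(fiber J') (to_rees J' (\val r)).
Proof.
move=> JJ'; have sub (p : rees J) : \val p \in in_rees J'.
  have /in_reesP pJ := valP p.
  by apply/in_reesP => j; apply: (ideal_exp_sub JJ').
pose h (p : rees J) := to_rees J' (\val p).
have hE p : \val (h p) = \val p by rewrite to_reesK.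
have hE' p : rees_val (h p) = rees_val p := hE p.
have hD p q : h (p + q) = h p + h q by apply/val_inj; rewrite hE !rmorphD /= !hE'.
have hM p q : h (p * q) = h p * h q by apply/val_inj; rewrite hE !rmorphM /= !hE'.
have hB p q : h (p - q) = h p - h q by apply/val_inj; rewrite hE !rmorphB /= !hE'.
have h_irr : irrelevant J `<=` [set p | irrelevant J' (h p)].
  have [i0 iD iM] : is_ideal (irrelevant J') by apply: ideal_gen_ideal.
  apply: ideal_gen_min => [|_ [i _ <-]] /=.
    split=> /= [|p q|c p].
    - by rewrite (_ : h 0 = 0) //; apply/val_inj; rewrite hE !rmorph0.
    - by rewrite hD; apply: iD.
    - by rewrite hM; apply: iM.
  apply: sub_ideal_gen; exists i => //; apply/val_inj.
  by rewrite hE !to_reesK ?rees_const_mem.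
apply/eqP; rewrite -Quotient.idealrBE; apply/asboolP.
rewrite -/(h _) -/(h r) -hB; apply: h_irr; apply/asboolP.
by rewrite -[asbool _]/(_ \in in_irrelevant J) Quotient.idealrBE reprK.
Qed.

Definition in_frac (p : {poly S}) : {fraction {poly S}} := tofrac p.

(* the localization of (+)_j closure(I^j) t^j at Q, inside Frac R[t] *)
Definition localization I (Q : set (rees_closure I)) : set {fraction {poly S}} :=
  [set z | exists a b : rees_closure I, ~ Q b /\ z = in_frac (\val a) / in_frac (\val b)].

Definition extended_ideal I : set (rees_closure I) :=
  ideal_gen [set r | exists2 f, I f & \val r = f%:P].

Definition rees_valuation I : set ({fraction {poly S}} -> int) :=
  [set v | normalized_valuation v /\
     exists2 Q, minimal_primes (extended_ideal I) Q
              & valuation_ring v = localization I Q].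

(* f in I and v f = v I = min {v g : g in I} (the minimum over nonzero g) *)
Definition attains_min I v (f : S) : Prop :=
  [/\ I f, f != 0 & forall g, I g -> g != 0 ->
     v (in_frac f%:P) <= v (in_frac g%:P)].

(* For a Rees valuation v = v_i, min_part I v is I_i; min_gens I v lists the j
   such that a_j is in G_i (equivalently y_j is in Y_i), and k[Y_i] has one
   variable for each of these j, via enum_val; outer_ideal I v is L_i. For a
   minimal prime p = p_il of F(I_i), lift_prime I v p is P_il. *)
Definition min_part I v : set S :=
  ideal_gen [set 'X_[k, a] | a in [set a | attains_min I v 'X_[a]]].

Definition min_gens I v : {set 'I_(ngens I)} :=
  [set j | `[< attains_min I v 'X_[gen I j] >]]%SET.

Definition min_gen I v (j : 'I_#|min_gens I v|) : 'X_{1..n} :=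
  gen I (enum_val j).

Definition outer_ideal I v : set (fiber I) :=
  ideal_gen [set fiber_class I 'X_[gen I j] | j in [set j | j \notin min_gens I v]].

Definition lift_prime I v (p : set (fiber (min_part I v))) : set (fiber I) :=
  ideal_gen ((fiber_incl (min_part I v) I) @` p `|` outer_ideal I v).

Definition lifted_primes I : set (set (fiber I)) :=
  fun P => exists v p,
    [/\ rees_valuation I v, minimal_primes [set 0] p & P = lift_prime I v p].

(* pres I is pi and pres_at I v is pi_i, with kernels K and K_i; pres_preim and
   pres_preim_at are the preimages Q and q of the image modulo the nilradical of
   a prime of F(I), resp. F(I_i); extend_Y I v a is (a, Y \ Y_i). *)
Definition pres I : {mpoly k[ngens I]} -> reduced (fiber I) :=
  presentation I _ (gen I).

Definition pres_at I v :
    {mpoly k[#|min_gens I v|]} -> reduced (fiber (min_part I v)) :=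
  presentation (min_part I v) _ (min_gen I v).

Definition pres_ker I : set {mpoly k[ngens I]} := [set f | pres I f = 0].

Definition pres_ker_at I v : set {mpoly k[#|min_gens I v|]} :=
  [set f | pres_at I v f = 0].

Definition pres_preim_at I v (p : set (fiber (min_part I v))) :
    set {mpoly k[#|min_gens I v|]} :=
  pres_at I v @^-1` (@to_reduced _ @` p).

Definition pres_preim I (P : set (fiber I)) : set {mpoly k[ngens I]} :=
  pres I @^-1` (@to_reduced _ @` P).

Definition embed_Y I v : {mpoly k[#|min_gens I v|]} -> {mpoly k[ngens I]} :=
  mmap (@mpolyC _ k) (fun j => 'X_(enum_val j)).

Definition extend_Y I v (a : set {mpoly k[#|min_gens I v|]}) :
    set {mpoly k[ngens I]} :=
  ideal_gen (embed_Y I v @` a `|`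
             [set 'X_j | j in [set j | j \notin min_gens I v]]).

End MonomialIdeals.

(* Main.v *)
Require Import Defs.
From HB Require Import structures.
From mathcomp Require Import all_boot all_order all_algebra.
From mathcomp Require Import generic_quotient ring_quotient fraction.
From mathcomp Require Import mpoly boolp classical_sets.
From mathcomp Require Import zify ring lra.

(** Monomials form a basis of the Rees ring, and each Rees valuation [v] is additive
    on them. For [a] in [I^s] one has [v (x^a) >= s * v I], and keeping only the
    monomials [x^a t^s] with equality is multiplicative. This truncation maps the
    Rees ring of [I] to the Rees ring of [I_v] and descends to a retraction of
    [F(I)] onto [F(I_v)], a left inverse of the inclusion, whose kernel is generated
    by the classes of the generators of [I] with [v > v I]
    (exists_fiber_retraction). Hence the ideal [P_il] is the preimage of [p_il], so
    it is prime, and the primes of [F(I)] containing that kernel are the preimages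
    of the primes of [F(I_v)]. The same happens for polynomial rings, with the map
    sending the variables outside [Y_i] to zero, and the two retractions commute
    with the presentations (fiber_retraction).

    Both parts of the theorem then reduce to one fact (prime_contains_outer): every
    prime [P] of [F(I)] contains the kernel belonging to some Rees valuation. Given
    it, [P] contains some [P_il], which yields (a); and an element of all the
    [P_il] lies in every prime, hence is nilpotent, which yields (b).

    To prove the fact, let [T] be the set of generators whose class is not in [P],
    and let [x^a] be their product. As its class is not nilpotent and [I] lies in
    the maximal ideal, [x^(M a)] is never in [I^(N + M |T|)] for [N > 0]. In terms
    of the cone spanned by the exponents of the [x_i] and of the [x^a t] with [x^a] a
    generator of [I], Farkas' lemma (farkas) gives a supporting hyperplane containing
    the exponents of [T] but leaving the direction of [t] on its negative side, and
    tilting it as long as possible (exists_facet) makes it a facet. The primitive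
    equation of the facet is a weight on monomials, hence a valuation of the
    field of fractions (frac_order_valuation). This is a Rees valuation
    (facet_rees_valuation): an integral element has nonnegative weight, while
    conversely a polynomial of nonnegative weight becomes integral over the Rees ring
    when multiplied by a high power of a monomial interior to the facet
    (facet_translate), so the valuation ring is the localization of the integral
    closure at the center of the valuation. By construction the minimum of the
    valuation on [I] is attained at all generators in [T], so those where it is not
    attained have their classes in [P]. *)

Set Implicit Arguments.
Unset Strict Implicit.
Unset Printing Implicit Defensive.

Import Order.TTheory GRing.Theory Num.Theory.
Local Open Scope classical_set_scope.
Local Open Scope ring_scope.
Local Open Scope quotient_scope.

(** * Primes and the nilradical *)

Section Primes.
Variable A : comNzRingType.
Implicit Types (P Q : set A) (x y : A).

Lemma prime_ideal_exp P x m : prime_ideal P -> P (x ^+ m) -> P x.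
Proof.
case=> _ P1 PM; elim: m => [|m IH]; first by rewrite expr0 => /P1.
by rewrite exprS => /PM[].
Qed.

Lemma prime_ideal_nilpotent P x m : prime_ideal P -> x ^+ m = 0 -> P x.
Proof.
by move=> pP x0; apply: (@prime_ideal_exp _ _ m) => //; rewrite x0; case: pP => -[].
Qed.

Lemma prime_ideal_prod (J : Type) (r : seq J) (D : pred J) (F : J -> A) P :
  prime_ideal P -> (forall j, D j -> ~ P (F j)) -> ~ P (\prod_(j <- r | D j) F j).
Proof.
by case=> _ P1 PM PF; elim/big_ind: _ => // x y Px Py /PM[].
Qed.

(** Among the ideals containing no power of a non-nilpotent [x], a maximal one
    is prime. Sets closed under addition and scaling are used in place of
    ideals so that the union of the empty chain qualifies. *)
Lemma exists_prime_avoiding x :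
  (forall m, x ^+ m <> 0) -> exists2 P, prime_ideal P & ~ P x.
Proof.
move=> xN0.
pose C : set (set A) := [set a | [/\ forall u v, a u -> a v -> a (u + v),
  forall c u, a u -> a (c * u) & forall m, ~ a (x ^+ m)]].
have [F FC totF|M [[MD MM Mx] Mmax]] := @Zorn_bigcup A C.
  split=> [u v [a Fa au] [b Fb bv]|c u [a Fa au]|m [a Fa]].
  - have [ab|ba] := totF _ _ Fa Fb.
      by exists b => //; case: (FC _ Fb) => D _ _; apply: D => //; apply: ab.
    by exists a => //; case: (FC _ Fa) => D _ _; apply: D => //; apply: ba.
  - by exists a => //; case: (FC _ Fa) => _ D _; apply: D.
  - by case: (FC _ Fa) => _ _; apply.
have M0 : M 0.
  apply: contrapT => nM0; apply: (Mmax [set 0]).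
    split=> [u Mu|/(_ 0 erefl)]; last exact: nM0.
    by case: nM0; rewrite -(mul0r u); apply: MM.
  split=> [u v -> ->|c u ->|m /xN0 //]; first exact: addr0.
  exact: mulr0.
have idM : is_ideal M by [].
have grow u : ~ M u -> exists c m y, M y /\ x ^+ m = c * u + y.
  move=> nMu; apply: contrapT => none.
  apply: (Mmax [set z | exists c y, M y /\ z = c * u + y]).
    split=> [y My|sub]; first by exists 0, y; rewrite mul0r add0r.
    by apply/nMu/sub; exists 1, 0; rewrite mul1r addr0.
  split=> [_ _ [c [y [My ->]]] [d [z [Mz ->]]]|d _ [c [y [My ->]]]|m [c [y [My e]]]].
  - by exists (c + d), (y + z); rewrite mulrDl addrACA; split=> //; apply: MD.
  - by exists (d * c), (d * y); rewrite mulrDr mulrA; split=> //; apply: MM.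
  - by apply: none; exists c, m, y.
exists M; last by move/(Mx 1%N).
split=> // [/(Mx 0%N) //|u v Muv].
apply: contrapT => /not_orP[/grow[c [m [y [My eu]]]] /grow[d [l [z [Mz ev]]]]].
apply: (Mx (m + l)%N); rewrite exprD eu ev mulrDl; apply: (MD); last first.
  by rewrite mulrC; apply: MM.
rewrite mulrDr; apply: (MD); last exact: MM.
by rewrite mulrACA; apply: MM.
Qed.

Lemma bigcap_chain_prime (G : set (set A)) : G !=set0 ->
  (forall Q, G Q -> prime_ideal Q) -> total_on G subset ->
  prime_ideal (\bigcap_(Q in G) Q).
Proof.
move=> [Q0 GQ0] Gp totG; split; first split.
- by move=> Q /Gp[[]].
- move=> x y Gx Gy Q GQ; have [[_ QD _] _ _] := Gp _ GQ.
  by apply: QD; [apply: Gx|apply: Gy].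
- move=> c x Gx Q GQ; have [[_ _ QM] _ _] := Gp _ GQ.
  by apply: QM; apply: Gx.
- by have [_ nQ1 _] := Gp _ GQ0; move=> /(_ _ GQ0).
move=> x y Gxy; apply: contrapT => /not_orP[].
move=> /existsNP[Q /not_implyP[GQ nQx]] /existsNP[R /not_implyP[GR nRy]].
have [QR|RQ] := totG _ _ GQ GR.
  by have [_ _ /(_ x y (Gxy _ GQ))[|/QR]] := Gp _ GQ.
by have [_ _ /(_ x y (Gxy _ GR))[/RQ|]] := Gp _ GR.
Qed.

(** Zorn's lemma yields maximal sets, hence the parametrization of the primes
    below [P] as [P `\` X] with [X] growing. It also makes the empty chain
    harmless: its union gives [P] itself. *)
Lemma exists_minimal_prime P :
  prime_ideal P -> exists2 Q, minimal_primes [set 0] Q & Q `<=` P.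
Proof.
move=> pP; pose C : set (set A) := [set X | prime_ideal (P `\` X)].
have [F FC totF|M [pM Mmax]] := @Zorn_bigcup A C.
  pose G := [set Q | Q = P \/ exists2 X, F X & Q = P `\` X].
  rewrite /C /= (_ : _ `\` _ = \bigcap_(Q in G) Q); last first.
    apply/seteqP; split=> [z [Pz nz] Q [->|[X FX ->]]|z Gz] //.
      by split=> // Xz; apply: nz; exists X.
    split=> [|[X FX Xz]]; first by apply: Gz; left.
    by have /(_ _)[|_] := Gz (P `\` X); first by right; exists X.
  apply: bigcap_chain_prime; first by exists P; left.
    by move=> Q [->|[X /FC pX ->]].
  move=> Q R [->|[X FX ->]] [->|[Y FY ->]]; try by [left|right => z []|left=> z []].
  by have [XY|YX] := totF _ _ FX FY; [right|left]; apply: setDS.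
exists (P `\` M); last by move=> z [].
split; first by split=> // _ ->; case: pM => -[].
move=> N [pN _] NQ; apply/seteqP; split=> // x [Px nMx].
apply: contrapT => nNx; apply: (Mmax (~` N)).
  split=> [y My /NQ[]//|/(_ x nNx)]; exact: nMx.
rewrite /C /= setDE setCK (_ : P `&` N = N) //.
by apply/seteqP; split=> [y []//|y Ny]; split=> //; case: (NQ _ Ny).
Qed.

Lemma minimal_prime_prime P : minimal_primes [set 0] P -> prime_ideal P.
Proof. by case=> -[]. Qed.

Lemma minimal_prime_eq P Q :
  minimal_primes [set 0] P -> prime_ideal Q -> Q `<=` P -> Q = P.
Proof.
by case=> _ minP pQ; apply: minP; split=> // x ->; case: pQ => -[].
Qed.

Lemma nilpotent_of_primes x :
  (forall P, prime_ideal P -> P x) -> exists m, x ^+ m = 0.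
Proof.
move=> Px; apply: contrapT => /forallNP/exists_prime_avoiding[P pP].
by apply; apply: Px.
Qed.

Lemma nilpotent_of_minimal_primes x :
  (forall P, minimal_primes [set 0] P -> P x) -> exists m, x ^+ m = 0.
Proof.
move=> Px; apply: nilpotent_of_primes => P /exists_minimal_prime[Q mQ].
by apply; apply: Px.
Qed.

Lemma to_reduced_eq x y :
  to_reduced x = to_reduced y <-> exists m, (x - y) ^+ m = 0.
Proof.
split=> [/eqP|e]; last apply/eqP; rewrite /to_reduced -Quotient.idealrBE.
  by move/asboolP.
exact/asboolP.
Qed.

Lemma to_reduced_eq0 x : to_reduced x = 0 <-> exists m, x ^+ m = 0.
Proof.
have -> : 0 = to_reduced (0 : A) by rewrite /to_reduced !piE.
by rewrite to_reduced_eq subr0.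
Qed.

Lemma to_reduced_prime P x :
  prime_ideal P -> (@to_reduced A @` P) (to_reduced x) <-> P x.
Proof.
move=> pP; split=> [[y Py /to_reduced_eq[m yx]]|Px]; last by exists x.
case: (pP) => -[_ PD PM] _ _; rewrite -(subrK y x).
apply: PD => //; rewrite -opprB -mulN1r; apply: PM.
exact: prime_ideal_nilpotent yx.
Qed.

End Primes.

(** Congruence modulo [L] of an element and of its image under the composite of
    two ring morphisms need only be checked on ring generators. *)
Section CongruentImage.
Variables (A A' : comNzRingType) (emb : {rmorphism A' -> A}).
Variables (psi : {rmorphism A -> A'}) (L : set A).
Hypothesis idL : is_ideal L.
Implicit Types x y : A.

Lemma congruent_imageD x y : L (x - emb (psi x)) -> L (y - emb (psi y)) ->
  L (x + y - emb (psi (x + y))).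
Proof. by case: idL => _ D _ Lx Ly; rewrite !rmorphD opprD addrACA; apply: D. Qed.

Lemma congruent_imageM x y : L (x - emb (psi x)) -> L (y - emb (psi y)) ->
  L (x * y - emb (psi (x * y))).
Proof.
case: idL => _ D M Lx Ly.
have -> : x * y - emb (psi (x * y)) =
    x * (y - emb (psi y)) + emb (psi y) * (x - emb (psi x)).
  rewrite !rmorphM !mulrBr (mulrC (emb (psi y)) x) (mulrC (emb (psi y)) (emb _)).
  by rewrite addrA subrK.
by apply: D; apply: M.
Qed.

End CongruentImage.

Section Retraction.
Variables (A A' : comNzRingType) (emb : A' -> A) (psi : {rmorphism A -> A'}).
Variable X : set A.
Hypothesis embK : cancel emb psi.
Hypothesis psiX : forall x, X x -> psi x = 0.
Hypothesis retrX : forall z, ideal_gen X (z - emb (psi z)).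

Lemma preimage_ideal (a : set A') : is_ideal a -> is_ideal (psi @^-1` a).
Proof.
case=> a0 aD aM; split=> [|x y ax ay|c x ax] /=.
- by rewrite rmorph0.
- by rewrite rmorphD; apply: aD.
- by rewrite rmorphM; apply: aM.
Qed.

Lemma preimage_prime (a : set A') : prime_ideal a -> prime_ideal (psi @^-1` a).
Proof.
case=> ida a1 aM; split=> [||x y] /=; first exact: preimage_ideal.
  by rewrite rmorph1.
by rewrite rmorphM => /aM.
Qed.

(** Modulo [X] an element is the image under [emb] of its image under [psi], and
    [X] lies in the kernel of [psi]. *)
Lemma ideal_gen_retract (a : set A') : is_ideal a ->
  ideal_gen (emb @` a `|` X) = psi @^-1` a.
Proof.
move=> ida; apply/seteqP; split.
  apply: (ideal_gen_min (preimage_ideal ida)) => y []; last first.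
    by move=> Xy; rewrite /= (psiX Xy); case: ida.
  by case=> z az <-; rewrite /= embK.
move=> z az; have [_ D _] := ideal_gen_ideal (emb @` a `|` X).
rewrite -(subrK (emb (psi z)) z); apply: D.
  apply: (ideal_gen_min (ideal_gen_ideal _) _ (retrX z)) => x Xx.
  by apply: sub_ideal_gen; right.
by apply: sub_ideal_gen; left; exists (psi z).
Qed.

(** [X] generates the kernel of [psi], so this is the correspondence between the
    primes of a quotient and the primes containing the kernel. *)
Lemma retract_prime (P : set A) : prime_ideal P -> X `<=` P ->
  prime_ideal (emb @^-1` P) /\ P = psi @^-1` (emb @^-1` P).
Proof.
move=> pP XP; have [[P0 PD PM] P1 Pp] := pP.
have LP : ideal_gen X `<=` P by apply: ideal_gen_min.
have eP y : P (emb (psi y)) <-> P y.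
  split=> Py; last first.
    rewrite -[emb _](subKr y); apply: PD => //.
    by apply: ideal_opp; [case: pP|apply: LP].
  by rewrite -(subrK (emb (psi y)) y); apply: PD => //; apply: LP.
split; last by apply/seteqP; split=> z /eP.
split; first split.
- by rewrite /= -(rmorph0 psi); apply/eP.
- move=> u w Pu Pw; rewrite /= -[u]embK -[w]embK -rmorphD; apply/eP.
  exact: PD.
- by move=> c u Pu; rewrite /= -[c]embK -[u]embK -rmorphM; apply/eP/PM.
- by rewrite /= -(rmorph1 psi) => /eP.
by move=> u w; rewrite /= -{1}[u]embK -{1}[w]embK -rmorphM => /eP/Pp.
Qed.

End Retraction.

(** * Facets of rational cones *)

Section NatSpan.
Variable V : nmodType.
Implicit Types (X B : set V).

(** Cones enter through the monoid spanned by their generators: a lattice point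
    lies in the rational cone when some positive multiple lies in the monoid. *)
Definition submonoid B : Prop := B 0 /\ forall x y, B x -> B y -> B (x + y).

Definition natspan X : set V := smallest submonoid X.

Lemma natspan_submonoid X : submonoid (natspan X).
Proof.
split=> [B [[]]//|x y hx hy B hB].
by case: (hB) => [[_ D] _]; apply: D; [apply: hx|apply: hy].
Qed.

Lemma natspan0 X : natspan X 0.
Proof. by case: (natspan_submonoid X). Qed.

Lemma natspanD X x y : natspan X x -> natspan X y -> natspan X (x + y).
Proof. by case: (natspan_submonoid X) => _; apply. Qed.

Lemma sub_natspan X : X `<=` natspan X.
Proof. exact: sub_smallest. Qed.

Lemma natspan_min X B : submonoid B -> X `<=` B -> natspan X `<=` B.
Proof. by move=> mB XB x; apply. Qed.

Lemma natspan_sub X Y : X `<=` Y -> natspan X `<=` natspan Y.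
Proof.
by move=> XY; apply: natspan_min (natspan_submonoid Y) _ => x /XY; apply: sub_natspan.
Qed.

Lemma natspanMn X x m : natspan X x -> natspan X (x *+ m).
Proof.
move=> Xx; elim: m => [|m IH]; first by rewrite mulr0n; apply: natspan0.
by rewrite mulrS; apply: natspanD.
Qed.

Lemma natspan_sum X (J : Type) (r : seq J) (D : pred J) (F : J -> V) :
  (forall j, D j -> natspan X (F j)) -> natspan X (\sum_(j <- r | D j) F j).
Proof.
by move=> XF; elim/big_ind: _ => //; [apply: natspan0|move=> *; apply: natspanD].
Qed.

End NatSpan.

Section Dot.
Variable d : nat.
Implicit Types (u v w x : 'rV[int]_d).

Definition dot u v : int := \sum_i u 0 i * v 0 i.

Lemma dotC u v : dot u v = dot v u.
Proof. by apply: eq_bigr => i _; rewrite mulrC. Qed.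

Lemma dotDl u v w : dot (u + v) w = dot u w + dot v w.
Proof. by rewrite -big_split; apply: eq_bigr => i _; rewrite mxE mulrDl. Qed.

Lemma dotZl a u w : dot (a *: u) w = a * dot u w.
Proof. by rewrite mulr_sumr; apply: eq_bigr => i _; rewrite mxE mulrA. Qed.

Lemma dotDr u v w : dot w (u + v) = dot w u + dot w v.
Proof. by rewrite dotC dotDl !(dotC w). Qed.

Lemma dotZr a u w : dot w (a *: u) = a * dot w u.
Proof. by rewrite dotC dotZl dotC. Qed.

Lemma dot0l w : dot 0 w = 0.
Proof. by rewrite -(scale0r w) dotZl mul0r. Qed.

Lemma dot0r w : dot w 0 = 0.
Proof. by rewrite dotC dot0l. Qed.

Lemma dotNl u w : dot (- u) w = - dot u w.
Proof. by rewrite -scaleN1r dotZl mulN1r. Qed.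

Lemma dotNr u w : dot w (- u) = - dot w u.
Proof. by rewrite dotC dotNl dotC. Qed.

Lemma dotMnl u w m : dot (u *+ m) w = dot u w *+ m.
Proof. by rewrite -scaler_nat dotZl mulr_natl. Qed.

Lemma dot_suml (J : Type) (r : seq J) (D : pred J) (F : J -> 'rV[int]_d) w :
  dot (\sum_(j <- r | D j) F j) w = \sum_(j <- r | D j) dot (F j) w.
Proof.
by elim/big_rec2: _ => [|j x y _ <-]; [exact: dot0l|exact: dotDl].
Qed.

Lemma dot_delta u i : dot u (delta_mx 0 i) = u 0 i.
Proof.
rewrite /dot (bigD1 i) //= mxE !eqxx mulr1 big1 ?addr0 // => j ji.
by rewrite mxE (negPf ji) andbF mulr0.
Qed.

(** Farkas' lemma over the integers, by induction on the generators: if [u0]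
    separates [b] from the other generators but is negative on [g], projecting
    everything along [g] onto the hyperplane orthogonal to [u0] removes [g]. *)
Lemma farkas (gs : seq 'rV[int]_d) (b : 'rV[int]_d) :
  (exists2 N, (0 < N)%N & natspan [set` gs] (b *+ N)) \/
  (exists2 u, (forall g, g \in gs -> 0 <= dot g u) & dot b u < 0).
Proof.
elim: {gs}(size gs) {-2}gs (erefl (size gs)) b => [|m IH] [|g gs] //= => [_|[sz]] b.
  have [->|b0] := eqVneq b 0.
    by left; exists 1%N => //; rewrite mul0rn; apply: natspan0.
  right; exists (- b) => //; rewrite dotNr oppr_lt0 lt0r sumr_ge0 ?andbT; last first.
    by move=> i _; rewrite -expr2 sqr_ge0.
  apply: contra b0 => /eqP; rewrite /dot => /psumr_eq0P e; apply/eqP/rowP => i.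
  rewrite mxE; apply/eqP; rewrite -sqrf_eq0 expr2; apply/eqP/e => // j _.
  by rewrite -expr2 sqr_ge0.
have gs_sub : [set` gs] `<=` [set` g :: gs] by move=> x /=; rewrite inE => ->; rewrite orbT.
have [[N N0 bN]|[u0 gsu0 bu0]] := IH _ sz b.
  by left; exists N => //; apply: natspan_sub bN.
have [gu0|gu0] := leP 0 (dot g u0).
  by right; exists u0 => // x; rewrite inE => /predU1P[->|/gsu0].
pose a := - dot g u0; have a0 : 0 < a by rewrite oppr_gt0.
pose pr x := a *: x + dot x u0 *: g.
have sz' : size (map pr gs) = m by rewrite size_map.
have [[N N0 bN]|[u gsu bu]] := IH _ sz' (pr b).
  left; exists (N * `|a|)%N; first by rewrite muln_gt0 N0 absz_gt0 gt_eqF.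
  have [x [xspan xu0 e]] : exists x, [/\ natspan [set` gs] x, 0 <= dot x u0
      & pr b *+ N = pr x].
    move: {b bu0} (pr b *+ N) bN; apply: natspan_min => [|_ /mapP[x xgs ->]].
      split=> [|_ _ [x [xs x0 ->]] [y [ys y0 ->]]].
        exists 0; rewrite /pr scaler0 add0r dot0l scale0r; split=> //.
        exact: natspan0.
      exists (x + y); rewrite dotDl addr_ge0 //; split=> //.
        exact: natspanD.
      by rewrite /pr scalerDr dotDl scalerDl addrACA.
    by exists x; split=> //; [apply: sub_natspan|apply: gsu0].
  pose c := dot x u0 - dot b u0 *+ N.
  have c0 : 0 <= c.
    by rewrite subr_ge0; apply: le_trans xu0; rewrite pmulrn_lle0 ?ltW.
  have -> : b *+ (N * `|a|) = x *+ `|a| + g *+ `|c|.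
    rewrite -!scaler_nat !natz !gez0_abs ?(ltW a0) // PoszM gez0_abs ?(ltW a0) //.
    move: e; rewrite /pr /c mulrnDl -!scaler_nat !scalerA !natz.
    move/(canRL (addrK _)) => ->.
    by rewrite -mulr_natl natz scalerBl addrA.
  apply: natspanD; apply: natspanMn.
    exact: natspan_sub xspan.
  by apply: sub_natspan; rewrite /= inE eqxx.
have pr_dot x : dot x (a *: u + dot g u *: u0) = dot (pr x) u.
  by rewrite dotDr !dotZr dotDl !dotZl (mulrC (dot g u)).
right; exists (a *: u + dot g u *: u0); last by rewrite pr_dot.
move=> x; rewrite inE pr_dot => /predU1P[->|xgs]; last exact/gsu/map_f.
by rewrite /pr -scalerDl addNr scale0r dot0l.
Qed.

End Dot.

(** A face is the zero set on the cone of a functional [l] nonnegative there. It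
    is a facet when the generators in it, together with a vector [t] outside its
    hyperplane, span the space, that is, when only the zero functional vanishes
    on them; in this form no dimension has to be counted. *)
Section Facet.
Variables (d : nat) (J : finType) (g : J -> 'rV[int]_d) (t : 'rV[int]_d).

Definition facet l :=
  [/\ forall j, 0 <= dot (g j) l, dot t l < 0
    & forall u, dot t u = 0 -> (forall j, dot (g j) l = 0 -> dot (g j) u = 0) ->
      u = 0].

(** The combinations using [- w] are read off after adding a multiple of [w]. *)
Lemma natspan_cons_opp w x :
  natspan [set` - w :: codom g] x -> exists c, natspan (range g) (x + w *+ c).
Proof.
move: x; apply: natspan_min.
  split=> [|x y [c xc] [e ye]].
    by exists 0%N; rewrite mulr0n addr0; apply: natspan0.
  by exists (c + e)%N; rewrite mulrnDr addrACA; apply: natspanD.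
move=> x /=; rewrite inE => /predU1P[->|/codomP[j ->]].
  by exists 1%N; rewrite addNr; apply: natspan0.
by exists 0%N; rewrite addr0; apply: sub_natspan; exists j.
Qed.

Hypothesis g_span : forall u, (forall j, dot (g j) u = 0) -> u = 0.

(** Tilting a supporting functional along directions orthogonal to [t] until
    it meets new generators ends with a facet. *)
Lemma exists_facet l : (forall j, 0 <= dot (g j) l) -> dot t l < 0 ->
  exists2 l', facet l' & forall j, dot (g j) l = 0 -> dot (g j) l' = 0.
Proof.
pose Z l := [set j | dot (g j) l == 0]%SET.
have [m] := ubnP #|~: Z l|; elim: m l => // m IH l; rewrite ltnS => le_m l0 lt.
have [full|] := pselect (forall u, dot t u = 0 ->
    (forall j, dot (g j) l = 0 -> dot (g j) u = 0) -> u = 0).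
  by exists l.
move=> /existsNP[u1 /not_implyP[tu1 /not_implyP[Zu1 u1_neq0]]].
have [u [tu Zu [j1 gu1]]] : exists u, [/\ dot t u = 0,
    forall j, dot (g j) l = 0 -> dot (g j) u = 0 & exists j, dot (g j) u < 0].
  have /existsNP[j /eqP gu] : ~ forall j, dot (g j) u1 = 0 by move=> /g_span.
  have [lt0|gt0|e] := ltgtP (dot (g j) u1) 0; last by rewrite e eqxx in gu.
    by exists u1; split=> //; exists j.
  exists (- u1); split; rewrite ?dotNr ?tu1 ?oppr0 //.
    by move=> i /Zu1; rewrite dotNr => ->; rewrite oppr0.
  by exists j; rewrite dotNr oppr_lt0.
(* the least ratio is the first time a generator is met *)
pose ratio j : rat := (dot (g j) l)%:~R / (- dot (g j) u)%:~R.
case: (@arg_minP _ _ _ j1 (fun j => dot (g j) u < 0) ratio gu1) => i gui imin.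
pose l' := (- dot (g i) u) *: l + dot (g i) l *: u.
have gl' j : dot (g j) l' = - dot (g i) u * dot (g j) l + dot (g i) l * dot (g j) u.
  by rewrite dotDr !dotZr.
have l'0 j : 0 <= dot (g j) l'.
  rewrite gl'; have [guj|guj] := leP 0 (dot (g j) u).
    by rewrite addr_ge0 // mulr_ge0 // oppr_ge0 ltW.
  have := imin _ guj; rewrite /ratio ler_pdivlMr ?ltr0z ?oppr_gt0 //.
  rewrite mulrAC ler_pdivrMr ?ltr0z ?oppr_gt0 // -!rmorphM ler_int.
  by move=> h; lra.
have t' : dot t l' < 0 by rewrite dotDr !dotZr tu mulr0 addr0 pmulr_rlt0 // oppr_gt0.
have Zl' j : dot (g j) l = 0 -> dot (g j) l' = 0.
  by move=> e; rewrite gl' e (Zu _ e) !mulr0 addr0.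
have iZ : i \in ~: Z l.
  by rewrite !inE; apply: contraTneq gui => /Zu ->; rewrite ltxx.
have [|//|//|l2 fl2 Zl2] := IH l'; last by exists l2 => // j /Zl'/Zl2.
apply: leq_trans le_m; apply: proper_card; apply/properP; split.
  by apply/fintype.subsetP => j; rewrite !inE; apply: contraNneq => /Zl' ->.
by exists i => //; rewrite !inE negbK gl' mulNr mulrC addNr.
Qed.

(** The cone is locally the half-space of a facet: an element [m] of the
    half-space gets into the cone once a large multiple of the sum of the
    generators of the facet is added. Otherwise Farkas' lemma would provide a
    functional vanishing on the facet, hence a multiple of [l], but negative
    on [m]. *)
Lemma facet_translate l m : facet l -> 0 <= dot m l ->
  exists N c, (0 < N)%N /\
    natspan (range g) ((m + (\sum_(j | dot (g j) l == 0) g j) *+ c) *+ N).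
Proof.
move=> [l0 tl ext] ml; set w := \sum_(j | _) _.
have [j0 gj0] : exists j, 0 < dot (g j) l.
  apply: contrapT => /forallNP none.
  have lz : l = 0.
    by apply: g_span => j; apply/eqP; rewrite eq_le l0 leNgt andbT; apply/negP.
  by rewrite lz dot0r ltxx in tl.
have [[N N0]|[u]] := farkas (- w :: codom g) m; last first.
  move=> gu mu.
  have gu0 j : 0 <= dot (g j) u by apply: gu; rewrite inE codom_f orbT.
  have wu : dot w u <= 0 by rewrite -oppr_ge0 -dotNl; apply: gu; rewrite inE eqxx.
  have Zu j : dot (g j) l = 0 -> dot (g j) u = 0.
    move=> e; move: wu; rewrite dot_suml => wu.
    have /psumr_eq0P : \sum_(j | dot (g j) l == 0) dot (g j) u = 0.
      by apply/eqP; rewrite eq_le wu sumr_ge0.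
    by apply=> //; apply/eqP.
  have e : dot t l *: u - dot t u *: l = 0.
    apply: ext; first by rewrite dotDr dotNr !dotZr mulrC subrr.
    by move=> j ej; rewrite dotDr dotNr !dotZr ej (Zu _ ej) !mulr0 subrr.
  have ex x : dot t l * dot x u = dot t u * dot x l.
    by apply/eqP; rewrite -subr_eq0 -!dotZr -dotNr -dotDr e dot0r.
  have tu : dot t u <= 0.
    by rewrite -(pmulr_lle0 _ gj0) -ex nmulr_rle0.
  have : 0 < dot t u * dot m l by rewrite -ex nmulr_rgt0.
  by rewrite ltNge mulr_le0_ge0.
move=> mN.
have [c wc] := natspan_cons_opp mN.
exists N, c; split=> //.
rewrite mulrnDl -mulrnA -[(c * N)%N](@subnKC c) ?leq_pmulr // mulrnDr addrA.
apply: natspanD => //; apply: natspanMn.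
apply: natspan_sum => j _.
by apply: sub_natspan; exists j.
Qed.

(** Dividing by the least positive value makes a facet functional take the
    value one. *)
Lemma facet_normalize l : facet l -> exists l', [/\ facet l',
  forall j, dot (g j) l = 0 -> dot (g j) l' = 0 & exists m, dot m l' = 1].
Proof.
move=> [l0 tl ext].
pose P D := `[< (0 < D)%N /\ exists m, dot m l = D%:Z >].
have exP : exists D, P D.
  exists `|dot t l|%N; apply/asboolP; split; first by rewrite absz_gt0 lt_eqF.
  by exists (- t); rewrite dotNl ltz0_abs.
case: (ex_minnP exP) => D /asboolP[D0 [m1 m1D]] Dmin.
have dvdD m : (D %| dot m l)%Z.
  apply/dvdz_mod0P; set r := (_ %% _)%Z.
  have r0 : 0 <= r by rewrite modz_ge0 // -lt0n.
  have rD : r < D by rewrite ltz_pmod.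
  apply: contrapT => /eqP rn0.
  have /Dmin : P `|r|%N.
    apply/asboolP; split; first by rewrite absz_gt0.
    exists (m + (- (dot m l %/ D)%Z) *: m1).
    by rewrite dotDl dotZl m1D gez0_abs // /r /modz mulNr.
  by rewrite -lez_nat gez0_abs // leNgt rD.
pose l' : 'rV[int]_d := \row_i divz (l 0 i) D.
have ll' : l = D%:Z *: l'.
  by apply/rowP => i; rewrite !mxE mulrC divzK // -dot_delta dotC.
have E x : dot x l = D%:Z * dot x l' by rewrite {1}ll' dotZr.
have Dp : 0 < D%:Z by rewrite ltz_nat.
exists l'; split; last first.
- exists m1; apply: (@mulfI _ D%:Z); first by rewrite gt_eqF.
  by rewrite -E mulr1.
- by move=> j /eqP; rewrite E mulf_eq0 gt_eqF // => /eqP.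
split=> [j||u tu Zu]; first by rewrite -(pmulr_rge0 _ Dp) -E.
  by rewrite -(pmulr_rlt0 _ Dp) -E.
by apply: ext => // j; rewrite E => /eqP; rewrite mulf_eq0 gt_eqF // => /eqP/Zu.
Qed.

End Facet.

Lemma seq_int_min (s : seq int) : s != [::] ->
  exists2 e, e \in s & forall x, x \in s -> e <= x.
Proof.
elim: s => // y s IH _; have [->|/IH[e es emin]] := eqVneq s [::].
  by exists y => [|x]; rewrite inE ?eqxx // => /eqP ->.
have [ye|ey] := leP y e.
  by exists y => [|x]; rewrite inE ?eqxx // => /predU1P[->//|/emin]; apply: le_trans.
exists e => [|x]; first by rewrite inE es orbT.
by rewrite inE => /predU1P[->|/emin//]; apply: ltW.
Qed.

Lemma frac_numden (A : idomainType) (z : {fraction A}) :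
  exists p q, q != 0 /\ z = FracField.tofrac p / FracField.tofrac q.
Proof.
elim/quotW: z => x; exists (frac x).1, (frac x).2.
have d0 := denom_ratioP x; split=> //.
apply: (@mulIf _ (FracField.tofrac (frac x).2)); first by rewrite tofrac_eq0.
rewrite divfK ?tofrac_eq0 //.
apply/eqP; rewrite -[_ * _]/(FracField.mul _ _) !piE FracField.equivfE /FracField.mulf.
by rewrite !numden_Ratio ?oner_eq0 ?mulr1 ?mul1r ?mulf_neq0 // mulrC.
Qed.

(** * Weights on k[x_1, ..., x_n][t] *)

Section Weights.
Variables (k : fieldType) (n : nat).
Local Notation S := {mpoly k[n]}.
Implicit Types (p q : {poly S}) (a b : 'X_{1..n}) (s r : nat) (e : int).

Lemma poly_mpolyP p q :
  (forall s a, (p`_s)@_a = (q`_s)@_a) -> p = q.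
Proof. by move=> e; apply/polyP => s; apply/mpolyP => a. Qed.

Lemma poly_mpoly_neq0 p : p != 0 -> exists s a, (p`_s)@_a != 0.
Proof.
move=> p0; apply: contrapT => none; case/eqP: p0; apply: poly_mpolyP => s a.
rewrite coef0 mcoeff0; apply/eqP/negPn/negP => c0; apply: none.
by exists s, a.
Qed.

Definition mono a s : {poly S} := 'X_[a] *: 'X^s.

Lemma coef_mono a s r b : ((mono a s)`_r)@_b = ((a == b) && (s == r))%:R.
Proof.
rewrite coefZ coefXn [r == s]eq_sym; case: (s == r); last by rewrite mulr0 mcoeff0 andbF.
by rewrite mulr1 mcoeffX andbT.
Qed.

Lemma monoM a b s r : mono a s * mono b r = mono (a + b)%MM (s + r).
Proof. by rewrite /mono -scalerAl -scalerAr scalerA -mpolyXD -exprD. Qed.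

Lemma mono_neq0 a s : mono a s != 0.
Proof.
apply/eqP => /(congr1 (fun p => (p`_s)@_a)) /eqP.
by rewrite coef_mono !eqxx coef0 mcoeff0 oner_eq0.
Qed.

Lemma monoXn a s m : mono a s ^+ m = mono (a *+ m)%MM (s * m).
Proof. by rewrite /mono exprZn mpolyXn -exprM. Qed.

Lemma mono_prod (J : Type) (r : seq J) (D : pred J) (F : J -> 'X_{1..n}) :
  \prod_(j <- r | D j) mono (F j) 1 =
  mono (\big[+%MM/0%MM]_(j <- r | D j) F j) (\sum_(j <- r | D j) 1).
Proof.
elim/big_rec3: _ => [|j x y z _ ->]; first by rewrite /mono mpolyX0 scale1r.
by rewrite monoM.
Qed.

(** A weight is an additive function of the exponent of [x^a t^s]; negative values
    are allowed, since [t] has negative weight for a Rees valuation. *)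
Variable w : 'X_{1..n} -> nat -> int.
Hypothesis wD : forall a b s r, w (a + b)%MM (s + r) = w a s + w b r.

Lemma weight0 : w 0%MM 0 = 0.
Proof. by apply: (addrI (w 0%MM 0)); rewrite -wD addm0 addr0. Qed.

Lemma weightMn a s m : w (a *+ m)%MM (s * m) = w a s *+ m.
Proof.
elim: m => [|m IH]; first by rewrite muln0 mulm0n weight0 mulr0n.
by rewrite mulmS mulnS wD IH mulrS.
Qed.

Definition weights_in (D : pred int) : set {poly S} :=
  [set p | forall s a, (p`_s)@_a != 0 -> D (w a s)].

Definition fil e := weights_in (fun x => e <= x).
Definition hom e := weights_in (fun x => x == e).

Lemma weights_in0 D : weights_in D 0.
Proof. by move=> s a; rewrite coef0 mcoeff0 eqxx. Qed.

Lemma weights_inD D p q :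
  weights_in D p -> weights_in D q -> weights_in D (p + q).
Proof.
move=> Dp Dq s a; rewrite coefD mcoeffD => pq.
have [p0|/Dp//] := eqVneq ((p`_s)@_a) 0.
by apply: Dq; rewrite p0 add0r in pq.
Qed.

Lemma weights_inN D p : weights_in D p -> weights_in D (- p).
Proof. by move=> Dp s a; rewrite coefN mcoeffN oppr_eq0; apply: Dp. Qed.

Lemma weights_inM (D1 D2 D3 : pred int) p q :
  (forall x y, D1 x -> D2 y -> D3 (x + y)) ->
  weights_in D1 p -> weights_in D2 q -> weights_in D3 (p * q).
Proof.
move=> D12 Dp Dq s a; rewrite coefM raddf_sum /= => nz.
have [i ci] : exists i : 'I_s.+1, (p`_i * q`_(s - i))@_a != 0.
  apply: contrapT => none; case/eqP: nz; apply: big1 => i _.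
  by apply/eqP/negPn/negP => ci; apply: none; exists i.
have : a \in msupp (p`_i * q`_(s - i)) by rewrite mcoeff_msupp.
move/msuppM_le/allpairsP => [[b c] /=]; rewrite !mcoeff_msupp => -[pb qc ->].
rewrite -(subnKC (_ : i <= s)%N); last by rewrite -ltnS.
by rewrite wD; apply: D12; [apply: Dp|apply: Dq].
Qed.

Lemma weights_in_mono (D : pred int) a s : weights_in D (mono a s) <-> D (w a s).
Proof.
split=> [/(_ s a)|Daw r b]; first by rewrite coef_mono !eqxx oner_eq0; apply.
by rewrite coef_mono; case: andP => [[/eqP <- /eqP <-]|]; rewrite ?eqxx.
Qed.

Lemma weights_inP (D1 D2 : pred int) p :
  (forall x, D1 x -> D2 x) -> weights_in D1 p -> weights_in D2 p.
Proof. by move=> D12 Dp s a /Dp/D12. Qed.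

Lemma filM e1 e2 p q : fil e1 p -> fil e2 q -> fil (e1 + e2) (p * q).
Proof. by apply: weights_inM => x y; apply: lerD. Qed.

Lemma homM e1 e2 p q : hom e1 p -> hom e2 q -> hom (e1 + e2) (p * q).
Proof. by apply: weights_inM => x y /eqP -> /eqP ->. Qed.

Lemma fil_le e1 e2 p : e1 <= e2 -> fil e2 p -> fil e1 p.
Proof. by move=> e12; apply: weights_inP => x; apply: le_trans. Qed.

Lemma hom_fil e p : hom e p -> fil e p.
Proof. by apply: weights_inP => x /eqP ->. Qed.

Lemma fil_exp e p m : fil e p -> fil (e *+ m) (p ^+ m).
Proof.
move=> ep; elim: m => [|m IH]; last by rewrite exprS mulrS; apply: filM.
rewrite (_ : p ^+ 0 = mono 0%MM 0); last by rewrite /mono mpolyX0 scale1r.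
by apply/weights_in_mono; rewrite weight0.
Qed.

(** The homogeneous component of weight [e]. *)
Definition part e p : {poly S} :=
  \poly_(s < size p) \sum_(a <- msupp p`_s | w a s == e) (p`_s)@_a *: 'X_[a].

Lemma coef_part e p s a :
  ((part e p)`_s)@_a = if w a s == e then (p`_s)@_a else 0.
Proof.
rewrite coef_poly; case: ltnP => [_|ps]; last first.
  by rewrite nth_default // !mcoeff0 if_same.
rewrite raddf_sum /= big_mkcond /=.
have [as_|aNs] := boolP (a \in msupp p`_s); last first.
  rewrite (memN_msupp_eq0 aNs) if_same big_seq big1 // => b bs.
  case: ifP => // _; rewrite mcoeffZ mcoeffX (_ : b == a = false) ?mulr0 //.
  by apply: contraNF aNs => /eqP <-.
rewrite (bigD1_seq a) ?msupp_uniq //= mcoeffZ mcoeffX eqxx mulr1 big1 ?addr0 //.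
by move=> b ba; case: ifP => // _; rewrite mcoeffZ mcoeffX (negPf ba) mulr0.
Qed.

Lemma part_hom e p : hom e (part e p).
Proof. by move=> s a; rewrite coef_part; case: ifP; rewrite ?eqxx. Qed.

Lemma partD e p q : part e (p + q) = part e p + part e q.
Proof.
apply: poly_mpolyP => s a.
rewrite coef_part !coefD !mcoeffD !coef_part.
by case: ifP; rewrite ?addr0.
Qed.

Lemma partN e p : part e (- p) = - part e p.
Proof.
apply: poly_mpolyP => s a; rewrite coef_part !coefN !mcoeffN coef_part.
by case: ifP; rewrite ?oppr0.
Qed.

Lemma partB e p q : part e (p - q) = part e p - part e q.
Proof. by rewrite partD partN. Qed.

Lemma part_id e p : hom e p -> part e p = p.
Proof.
move=> hp; apply: poly_mpolyP => s a; rewrite coef_part; case: ifP => // we.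
by apply/esym/eqP/negPn; apply: contraFN we => /hp.
Qed.

Lemma part_eq0 e p : fil (e + 1) p -> part e p = 0.
Proof.
move=> hp; apply: poly_mpolyP => s a; rewrite coef_part coef0 mcoeff0.
case: ifP => // /eqP we; apply/eqP/negPn/negP => /hp; rewrite we; lia.
Qed.

Lemma fil_subr_part e p : fil e p -> fil (e + 1) (p - part e p).
Proof.
move=> hp s a; rewrite coefB mcoeffB coef_part.
case: ifP => [_|we]; first by rewrite subrr eqxx.
by rewrite subr0 => /hp; move: we => /eqP; lia.
Qed.

(** The components of lowest weight multiply, everything else contributing only
    to higher weights. *)
Lemma partM e1 e2 p q : fil e1 p -> fil e2 q ->
  part (e1 + e2) (p * q) = part e1 p * part e2 q.
Proof.
move=> hp hq; rewrite -[X in part _ X](subrK (part e1 p * part e2 q)) partD.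
rewrite (part_id (homM (@part_hom _ _) (@part_hom _ _))) part_eq0 ?add0r //.
have -> : p * q - part e1 p * part e2 q =
  part e1 p * (q - part e2 q) + (p - part e1 p) * q by ring.
apply: weights_inD.
  by rewrite -addrA; apply: filM (hom_fil (@part_hom _ _)) (fil_subr_part hq).
by rewrite addrAC; apply: filM (fil_subr_part hp) hq.
Qed.

Lemma part_mono a s e : part e (mono a s) = if w a s == e then mono a s else 0.
Proof.
apply: poly_mpolyP => r b; rewrite coef_part coef_mono.
case: andP => [[/eqP <- /eqP <-]|ab].
  by case: ifP; rewrite ?coef_mono ?eqxx // coef0 mcoeff0.
case: ifP => _; case: ifP => _; rewrite ?coef0 ?mcoeff0 // coef_mono;
  by case: andP.
Qed.

Lemma exists_order p : p != 0 -> exists e, fil e p /\ ~ fil (e + 1) p.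
Proof.
move=> /poly_mpoly_neq0[s [a pa]].
pose L := [seq w b r | r <- iota 0 (size p), b <- msupp p`_r].
have LP r b : (p`_r)@_b != 0 -> w b r \in L.
  move=> pb; apply/allpairsPdep; exists r, b; split=> //; last by rewrite mcoeff_msupp.
  rewrite mem_iota add0n; apply: contraNT pb; rewrite -leqNgt => /leq_sizeP -> //.
  by rewrite mcoeff0.
have [|e /allpairsPdep[r [b [_ pb ->]]] emin] := @seq_int_min L.
  by apply: contraTneq (LP _ _ pa) => ->.
exists (w b r); split=> [r' b' /LP/emin//|/(_ r b)].
by rewrite -mcoeff_msupp => /(_ pb); lia.
Qed.

(** The least weight of a monomial of [p], for [p] nonzero. *)
Definition weight_order p : int := xget 0 [set e | fil e p /\ ~ fil (e + 1) p].

Lemma weight_orderP p e : p != 0 -> fil e p <-> e <= weight_order p.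
Proof.
move=> /exists_order[e' e'P].
have [fo nfo] : fil (weight_order p) p /\ ~ fil (weight_order p + 1) p.
  by apply: (@xgetPex _ 0 [set e | fil e p /\ ~ fil (e + 1) p]); exists e'.
split=> [fe|/fil_le]; last exact.
by rewrite leNgt; apply/negP => lt; apply: nfo; apply: fil_le fe; lia.
Qed.

Lemma weight_order_eq p e : fil e p -> ~ fil (e + 1) p -> weight_order p = e.
Proof.
move=> fe nfe; have p0 : p != 0.
  by apply/eqP => p0; apply: nfe; rewrite p0; apply: weights_in0.
by move: fe nfe => /(weight_orderP _ p0) + /(weight_orderP _ p0); lia.
Qed.

Lemma weight_order_part_neq0 p : p != 0 -> part (weight_order p) p != 0.
Proof.
move=> p0; apply/eqP => e.
have := fil_subr_part ((weight_orderP _ p0).2 (lexx _)).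
by rewrite e subr0 => /(weight_orderP _ p0); lia.
Qed.

(** The product of the lowest components is nonzero, for polynomials over a
    field form a domain; so the order is additive. *)
Lemma weight_orderM p q : p != 0 -> q != 0 ->
  weight_order (p * q) = weight_order p + weight_order q.
Proof.
move=> p0 q0.
have fp : fil (weight_order p) p by apply/(weight_orderP _ p0).
have fq : fil (weight_order q) q by apply/(weight_orderP _ q0).
apply: weight_order_eq; first exact: filM.
move/part_eq0; rewrite partM // => /eqP.
by rewrite mulf_eq0 !(negPf (weight_order_part_neq0 _)).
Qed.

Lemma weight_orderD p q : p != 0 -> q != 0 -> p + q != 0 ->
  Num.min (weight_order p) (weight_order q) <= weight_order (p + q).
Proof.
move=> p0 q0 pq0; apply/(weight_orderP _ pq0); apply: weights_inD.
  by apply: (@fil_le _ (weight_order p)); [rewrite ge_min lexx|apply/(weight_orderP _ p0)].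
by apply: (@fil_le _ (weight_order q)); [rewrite ge_min lexx orbT|apply/(weight_orderP _ q0)].
Qed.

Lemma weight_order_mono a s : weight_order (mono a s) = w a s.
Proof.
by apply: weight_order_eq; [apply/weights_in_mono|move/weights_in_mono; lia].
Qed.

Definition frac_order (z : {fraction {poly S}}) : int :=
  xget 0 [set e | exists p q, [/\ p != 0, q != 0, z = in_frac p / in_frac q
                              & e = weight_order p - weight_order q]].

Lemma in_frac_eq0 p : (in_frac p == 0) = (p == 0).
Proof. exact: tofrac_eq0. Qed.

Lemma in_fracM p q : in_frac (p * q) = in_frac p * in_frac q.
Proof. exact: tofracM. Qed.

Lemma in_fracD p q : in_frac (p + q) = in_frac p + in_frac q.
Proof. exact: tofracD. Qed.

Lemma in_frac_inj p q : in_frac p = in_frac q -> p = q.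
Proof. by move/eqP; rewrite tofrac_eq => /eqP. Qed.

Lemma frac_orderE p q : p != 0 -> q != 0 ->
  frac_order (in_frac p / in_frac q) = weight_order p - weight_order q.
Proof.
move=> p0 q0; rewrite /frac_order.
have [|p' [q' [p'0 q'0 e ->]]] := @xgetPex _ 0 [set e | exists p' q',
    [/\ p' != 0, q' != 0, in_frac p / in_frac q = in_frac p' / in_frac q'
      & e = weight_order p' - weight_order q']].
  by exists (weight_order p - weight_order q); exists p, q.
move: e => /eqP; rewrite eqr_div ?in_frac_eq0 // -!in_fracM => /eqP/in_frac_inj.
by move/(congr1 weight_order); rewrite !weight_orderM //; lia.
Qed.

Lemma frac_order_poly p : p != 0 -> frac_order (in_frac p) = weight_order p.
Proof.
move=> p0; have -> : in_frac p = in_frac p / in_frac 1 by rewrite /in_frac tofrac1 divr1.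
rewrite frac_orderE ?oner_eq0 // (_ : 1 = mono 0%MM 0) ?weight_order_mono ?weight0 ?subr0 //.
by rewrite /mono mpolyX0 scale1r.
Qed.

Lemma frac_order_valuation : (exists a s, w a s = 1) ->
  normalized_valuation frac_order.
Proof.
have fracE z : z != 0 -> exists p q, [/\ p != 0, q != 0 & z = in_frac p / in_frac q].
  have [p [q [q0 ->]]] := frac_numden z => nz; exists p, q; split=> //.
  by apply: contraNneq nz => ->; rewrite tofrac0 mul0r.
have arith (x y x' y' e : int) : Num.min (x + y') (x' + y) <= e ->
    Num.min (x - y) (x' - y') <= e - (y + y').
  by rewrite !ge_min => /orP[] ?; apply/orP; [left|right]; lia.
move=> [a [s was]]; split.
- rewrite /frac_order; case: xgetP => // e _ [p [q [p0 q0 /esym/eqP]]].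
  by rewrite mulf_eq0 invr_eq0 !in_frac_eq0 (negPf p0) (negPf q0).
- move=> x y /fracE[p [q [p0 q0 ->]]] /fracE[p' [q' [p'0 q'0 ->]]].
  by rewrite mulf_div -!in_fracM !frac_orderE ?mulf_neq0 // !weight_orderM //; lia.
- move=> x y /fracE[p [q [p0 q0 ->]]] /fracE[p' [q' [p'0 q'0 ->]]].
  rewrite addf_div ?in_frac_eq0 // -!in_fracM -in_fracD => nz.
  have nz' : p * q' + p' * q != 0.
    by apply: contraNneq nz => ->; rewrite /in_frac tofrac0 mul0r.
  rewrite !frac_orderE ?mulf_neq0 // weight_orderM //.
  have := weight_orderD (mulf_neq0 p0 q'0) (mulf_neq0 p'0 q0) nz'.
  rewrite !weight_orderM //; apply: arith.
- by exists (in_frac (mono a s)); rewrite ?in_frac_eq0 ?mono_neq0 //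
    frac_order_poly ?mono_neq0 // weight_order_mono.
Qed.

End Weights.

(** * Monomial ideals, Rees rings and fiber rings *)

Section MonomialIdealFacts.
Variables (k : fieldType) (n : nat).
Local Notation S := {mpoly k[n]}.
Implicit Types (J : set S) (a b : 'X_{1..n}).

Lemma mpolyX_mem J a b : is_ideal J -> (b <= a)%MM -> J 'X_[b] -> J 'X_[a].
Proof. by case=> _ _ JM ba Jb; rewrite -(submK ba) mpolyXD; apply: JM. Qed.

Lemma gen_mem J (j : 'I_(ngens J)) : J 'X_[gen J j].
Proof.
have : gen J j \in gens J by apply: mem_nth; apply: ltn_ord.
by rewrite mem_gens => /asboolP[].
Qed.

(** Descent on the degree: a monomial of [J] that is not minimal is a proper
    multiple of another one. *)
Lemma gen_below J a : J 'X_[a] -> exists j : 'I_(ngens J), (gen J j <= a)%MM.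
Proof.
have [m] := ubnP (mdeg a); elim: m a => // m IH a /ltnSE le_am Ja.
have [min_a|/not_andP[//|]] := EM (min_monomials J a).
  have /(nthP 0%MM)[i ilt ai] : a \in gens J by rewrite mem_gens; apply/asboolP.
  by exists (Ordinal ilt); rewrite /gen /= ai lepm_refl.
move=> /existsNP[b /not_implyP[Jb /not_implyP[ba nba]]].
have [|j jb] := IH b _ Jb; last by exists j; apply: lepm_trans ba.
apply: leq_trans le_am; rewrite -(submK ba) mdegD -[leqLHS]add1n leq_add2r.
rewrite lt0n mdeg_eq0; apply/eqP => ab0; apply: nba.
by rewrite -(submK ba) ab0 add0m.
Qed.

Lemma monomial_ideal_is_ideal J : monomial_ideal J -> is_ideal J.
Proof. by case=> M ->; apply: ideal_gen_ideal. Qed.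

Lemma ideal_gen_gens J : monomial_ideal J ->
  J = ideal_gen [set 'X_[a] | a in range (gen J)].
Proof.
move=> mJ; have idJ := monomial_ideal_is_ideal mJ; apply/seteqP; split; last first.
  by apply: (ideal_gen_min idJ) => _ [_ [j _ <-] <-]; apply: gen_mem.
case: (mJ) => M eJ; rewrite {1}eJ; apply: ideal_gen_min (ideal_gen_ideal _) _.
move=> _ [a Ma <-]; have /gen_below[j ja] : J 'X_[a].
  by rewrite eJ; apply: sub_ideal_gen; exists a.
by apply: mpolyX_mem (ideal_gen_ideal _) ja _; apply: sub_ideal_gen; exists (gen J j).
Qed.

Definition maximal_ideal : set S := ideal_gen (range (fun i : 'I_n => 'X_i)).

Lemma sub_maximal_ideal J : monomial_ideal J -> J <> setT -> J `<=` maximal_ideal.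
Proof.
move=> [M eJ] J1; rewrite eJ; apply: (@ideal_gen_min _ _ maximal_ideal).
  exact: ideal_gen_ideal.
move=> _ [a Ma <-]; have a0 : a != 0%MM.
  apply/eqP => a0; apply: J1; apply/seteqP; split=> // f _.
  have idJ : is_ideal J by rewrite eJ; apply: ideal_gen_ideal.
  case: (idJ) => _ _ JM; rewrite -[f]mulr1; apply: JM.
  by rewrite -mpolyX0 -a0 eJ; apply: sub_ideal_gen; exists a.
have /existsP[i ai] : [exists i, a i != 0%N].
  apply: contraNT a0; rewrite negb_exists => /forallP a0; apply/eqP/mnmP => i.
  by rewrite mnm0E; apply/eqP; move: (a0 i); rewrite negbK.
apply: (@mpolyX_mem maximal_ideal a U_(i)%MM); first exact: ideal_gen_ideal.
  by rewrite lep1mP.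
by apply: sub_ideal_gen; exists i.
Qed.

End MonomialIdealFacts.

Arguments maximal_ideal {k n}.

Lemma ideal_exp_leq (R : comNzRingType) (J : set R) i j :
  (i <= j)%N -> ideal_exp J j `<=` ideal_exp J i.
Proof.
move/subnKC <-; elim: (j - i)%N => [|e IH]; first by rewrite addn0.
rewrite addnS ideal_expS; apply: (ideal_gen_min (ideal_exp_ideal J i)).
move=> _ [x [y [_ /IH Jy ->]]].
by have [_ _ JM] := ideal_exp_ideal J i; apply: JM.
Qed.

(** The Rees ring of an ideal generated by [X] is generated as a ring by the
    constants and the [x t] for [x] in [X]. *)
Lemma rees_ind (R : comNzRingType) (X : set R) (B : set {poly R}) :
  (forall p q, B p -> B q -> B (p + q)) -> (forall p q, B p -> B q -> B (p * q)) ->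
  (forall c, B c%:P) -> (forall x, X x -> B (x *: 'X)) ->
  forall p, p \in in_rees (ideal_gen X) -> B p.
Proof.
move=> BD BM BC BX.
have BXn s : is_ideal [set f : R | B (f *: 'X^s)].
  split=> /= [|f g Bf Bg|c f Bf].
  - by rewrite scale0r -polyC0.
  - by rewrite scalerDl; apply: BD.
  - by rewrite -scalerA -mul_polyC; apply: BM.
have B1 : ideal_gen X `<=` [set f : R | B (f *: 'X)] := ideal_gen_min (BXn 1%N) BX.
have Bs s : ideal_exp (ideal_gen X) s `<=` [set f : R | B (f *: 'X^s)].
  elim: s => [|s IH]; first by move=> f _; rewrite /= expr0 alg_polyC.
  apply: (ideal_gen_min (BXn s.+1)) => _ [f [g [/B1 Bf /IH Bg ->]]] /=.
  by rewrite exprS -scalerA scalerAr scalerAl; apply: BM.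
move=> p /in_reesP Jp; rewrite -[p]coefK poly_def.
by elim/big_ind: _ => [|//|i _]; [rewrite -polyC0|apply: Bs].
Qed.

(** Packs a ring morphism whose construction depends on the context, such as the
    maps of Rees rings attached to a given valuation. *)
Definition mk_rmorph (A B : comNzRingType) (f : A -> B) (fB : {morph f : x y / x - y})
  (fM : {morph f : x y / x * y}) (f1 : f 1 = 1) : {rmorphism A -> B}.
Proof.
pose m1 := GRing.isZmodMorphism.Build _ _ f fB.
pose m2 := GRing.isMonoidMorphism.Build _ _ f (conj f1 fM).
exact: (HB.pack f m1 m2).
Defined.

Section FiberFacts.
Variables (k : fieldType) (n : nat).
Local Notation S := {mpoly k[n]}.
Implicit Types (J : set S) (a b : 'X_{1..n}).

Definition fiber_pi J : {rmorphism rees J -> fiber J} :=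
  \pi_{ideal_quot (in_irrelevant J)}.

Lemma fiber_pi_eq0 J (r : rees J) : fiber_pi J r = 0 <-> irrelevant J r.
Proof.
rewrite -(rmorph0 (fiber_pi J)); split=> [/eqP|r0].
  by rewrite -Quotient.idealrBE subr0 => /asboolP.
by apply/eqP; rewrite -Quotient.idealrBE subr0; apply/asboolP.
Qed.

Lemma fiber_pi_surj J (z : fiber J) : exists r, fiber_pi J r = z.
Proof. by exists (repr z); apply: reprK. Qed.

Lemma to_rees_val J (r : rees J) : to_rees J (\val r) = r.
Proof. by apply: val_inj; rewrite to_reesK //; apply: (valP r). Qed.

Lemma to_rees0 J : to_rees J 0 = 0.
Proof. by apply: val_inj; rewrite to_reesK ?rmorph0 ?rpred0. Qed.

Lemma to_rees1 J : to_rees J 1 = 1.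
Proof. by apply: val_inj; rewrite to_reesK ?rmorph1 ?rpred1. Qed.

Lemma to_reesD J (p q : {poly S}) : p \in in_rees J -> q \in in_rees J ->
  to_rees J (p + q) = to_rees J p + to_rees J q.
Proof.
move=> Jp Jq; apply: val_inj; rewrite (to_reesK (rpredD Jp Jq)) rmorphD /=.
by rewrite -!/(\val (to_rees _ _)) (to_reesK Jp) (to_reesK Jq).
Qed.

Lemma to_reesM J (p q : {poly S}) : p \in in_rees J -> q \in in_rees J ->
  to_rees J (p * q) = to_rees J p * to_rees J q.
Proof.
move=> Jp Jq; apply: val_inj; rewrite (to_reesK (rpredM Jp Jq)) rmorphM /=.
by rewrite -!/(\val (to_rees _ _)) (to_reesK Jp) (to_reesK Jq).
Qed.

Lemma to_reesB J (p q : {poly S}) : p \in in_rees J -> q \in in_rees J ->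
  to_rees J (p - q) = to_rees J p - to_rees J q.
Proof.
move=> Jp Jq; apply: val_inj; rewrite (to_reesK (rpredB Jp Jq)) rmorphB /=.
by rewrite -!/(\val (to_rees _ _)) (to_reesK Jp) (to_reesK Jq).
Qed.

(** The special fiber ring is generated over [k] in degree one, by the classes of
    any set of monomials generating the ideal: the variables [x_i] die in it. *)
Lemma fiber_ind (M : set 'X_{1..n}) J (B : set (fiber J)) :
  J = ideal_gen [set 'X_[k, a] | a in M] ->
  (forall y z, B y -> B z -> B (y + z)) -> (forall y z, B y -> B z -> B (y * z)) ->
  (forall c, B (fiber_const J c)) -> (forall a, M a -> B (fiber_class J 'X_[a])) ->
  forall z, B z.
Proof.
move=> eJ BD BM BC BX z; have [r <-] := fiber_pi_surj z.
pose B' := [set p | p \in in_rees J /\ B (fiber_pi J (to_rees J p))].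
have BD' p q : B' p -> B' q -> B' (p + q).
  by move=> [Jp Bp] [Jq Bq]; split; [rewrite rpredD|rewrite to_reesD // rmorphD; apply: BD].
have BM' p q : B' p -> B' q -> B' (p * q).
  by move=> [Jp Bp] [Jq Bq]; split; [rewrite rpredM|rewrite to_reesM // rmorphM; apply: BM].
have BCk c : B' (c%:MP)%:P by split; [exact: rees_const_mem|exact: BC].
have BC1 : B' 1 by move: (BCk 1); rewrite mpolyC1.
have BCX i : B' ('X_i)%:P.
  split; first exact: rees_const_mem.
  rewrite (_ : fiber_pi J _ = fiber_const J 0); first exact: BC.
  rewrite /fiber_const mpolyC0 polyC0 to_rees0.
  rewrite -[RHS]/(fiber_pi J 0) rmorph0.
  by apply/fiber_pi_eq0; apply: sub_ideal_gen; exists i.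
have BC' f : B' f%:P.
  elim/mpolyind: f => [|c a f _ _ Bf]; first by move: (BCk 0); rewrite mpolyC0.
  rewrite polyCD; apply: (BD'); last exact: Bf.
  rewrite -mul_mpolyC polyCM; apply: (BM'); first exact: BCk.
  rewrite mpolyXE_id.
  rewrite rmorph_prod.
  elim/big_ind: _ => [||i _]; [exact: BC1|exact: BM'|].
  rewrite rmorphXn; elim: (a i) => [|m IH]; first by rewrite expr0.
  by rewrite exprS; apply: BM' (BCX i) IH.
have [_] : B' (\val r); last by rewrite to_rees_val.
move: (valP r); rewrite /= {2}eJ; apply: rees_ind BD' BM' BC' _ _ => _ [a Ma <-].
split; last exact: BX.
by apply: rees_deg1_mem; rewrite eJ; apply: sub_ideal_gen; exists a.
Qed.

Lemma rees_var_irrelevant J (f : S) : maximal_ideal f ->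
  irrelevant J (to_rees J f%:P).
Proof.
move: f; have [i0 iD iM] : is_ideal (irrelevant J) by apply: ideal_gen_ideal.
apply: ideal_gen_min => [|_ [i _ <-]]; last by apply: sub_ideal_gen; exists i.
split=> [|f g If Ig|c f If] /=.
- by rewrite polyC0 to_rees0.
- by rewrite polyCD to_reesD ?rees_const_mem //; apply: iD If Ig.
- by rewrite polyCM to_reesM ?rees_const_mem //; apply: iM If.
Qed.

Lemma in_rees_mono J s (f : S) : ideal_exp J s f -> f *: 'X^s \in in_rees J.
Proof.
move=> Jf; apply/in_reesP => r; rewrite coefZ coefXn; case: eqP => [->|_].
  by rewrite mulr1.
by rewrite mulr0; apply: ideal_exp_mem0.
Qed.

(** Elements of [J^(s+1)] vanish in degree [s] of the fiber ring, because [J]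
    lies in the maximal ideal. *)
Lemma ideal_expS_irrelevant J s (f : S) :
  J `<=` maximal_ideal -> ideal_exp J s.+1 f ->
  f *: 'X^s \in in_rees J /\ irrelevant J (to_rees J (f *: 'X^s)).
Proof.
move=> Jm; have [i0 iD iM] : is_ideal (irrelevant J) by apply: ideal_gen_ideal.
have id : is_ideal [set f : S | f *: 'X^s \in in_rees J
    /\ irrelevant J (to_rees J (f *: 'X^s))].
    split=> /= [|f1 f2 [J1 I1] [J2 I2]|c f1 [J1 I1]].
  - by rewrite scale0r rpred0 to_rees0.
  - by rewrite scalerDl rpredD // to_reesD //; split=> //; apply: iD I1 I2.
  - rewrite -scalerA -mul_polyC rpredM ?rees_const_mem // to_reesM ?rees_const_mem //.
    by split=> //; apply: iM I1.
move: f; apply: (ideal_gen_min id) => _ [f [g [Jf Jg ->]]] /=.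
have fJ := rees_const_mem J f; have gJ := in_rees_mono Jg.
rewrite -scalerA -mul_polyC mulrC rpredM // to_reesM //; split=> //.
by apply: iM; apply: rees_var_irrelevant; apply: Jm.
Qed.

Section FiberMap.
Variables (J J' : set S) (h : {rmorphism rees J -> rees J'}).
Hypothesis h_irr : forall i : 'I_n, irrelevant J' (h (to_rees J ('X_i)%:P)).

Definition fiber_map (z : fiber J) : fiber J' := \pi_(fiber J') (h (repr z)).

(** The value does not depend on the representative since [h] maps the generators
    of the irrelevant ideal into the irrelevant ideal. *)
Lemma fiber_mapE r : fiber_map (fiber_pi J r) = fiber_pi J' (h r).
Proof.
have [i0 iD iM] : is_ideal (irrelevant J') by apply: ideal_gen_ideal.
have irr : irrelevant J `<=` [set p | irrelevant J' (h p)].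
  apply: ideal_gen_min => [|_ [i _ <-]] //=.
  by split=> /= [|p q|c p]; rewrite ?rmorph0 // ?rmorphD ?rmorphM; [apply: iD|apply: iM].
have /irr hr : irrelevant J (repr (fiber_pi J r) - r).
  apply/fiber_pi_eq0; rewrite rmorphB; apply/eqP; rewrite subr_eq0; apply/eqP.
  exact: reprK.
apply/eqP; rewrite -subr_eq0 -[fiber_map _]/(fiber_pi J' _) -!rmorphB.
by apply/eqP/fiber_pi_eq0.
Qed.

Lemma fiber_mapB : {morph fiber_map : x y / x - y}.
Proof.
move=> x y; have [[r <-] [s <-]] := (fiber_pi_surj x, fiber_pi_surj y).
by rewrite -rmorphB !fiber_mapE !rmorphB.
Qed.

Lemma fiber_mapM : {morph fiber_map : x y / x * y}.
Proof.
move=> x y; have [[r <-] [s <-]] := (fiber_pi_surj x, fiber_pi_surj y).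
by rewrite -rmorphM !fiber_mapE !rmorphM.
Qed.

Lemma fiber_map1 : fiber_map 1 = 1.
Proof. by rewrite -(rmorph1 (fiber_pi J)) fiber_mapE !rmorph1. Qed.

Definition fiber_rmorph : {rmorphism fiber J -> fiber J'} :=
  mk_rmorph fiber_mapB fiber_mapM fiber_map1.

End FiberMap.

Lemma fiber_constB J : {morph fiber_const J : c d / c - d}.
Proof.
move=> c d; rewrite /fiber_const -!/(fiber_pi J _) -rmorphB; congr (fiber_pi J _).
by rewrite mpolyCB polyCB to_reesB ?rees_const_mem.
Qed.

Lemma fiber_constM J : {morph fiber_const J : c d / c * d}.
Proof.
move=> c d; rewrite /fiber_const -!/(fiber_pi J _) -rmorphM; congr (fiber_pi J _).
by rewrite mpolyCM polyCM to_reesM ?rees_const_mem.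
Qed.

Lemma fiber_const1 J : fiber_const J 1 = 1.
Proof.
rewrite /fiber_const mpolyC1 polyC1 to_rees1; exact: (rmorph1 (fiber_pi J)).
Qed.

Definition fiber_constr J : {rmorphism k -> fiber J} :=
  mk_rmorph (@fiber_constB J) (@fiber_constM J) (@fiber_const1 J).

(** The presentation of the fiber ring itself, before its nilradical is divided
    out. *)
Definition fiber_pres J m (a : 'I_m -> 'X_{1..n}) : {rmorphism {mpoly k[m]} -> fiber J} :=
  mmap (fiber_constr J) (fun j => fiber_class J 'X_[a j]).

Lemma fiber_presC J m (a : 'I_m -> 'X_{1..n}) c :
  fiber_pres J a c%:MP = fiber_const J c.
Proof. exact: (mmapC _ (fiber_constr J) c). Qed.

Lemma fiber_presX J m (a : 'I_m -> 'X_{1..n}) i :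
  fiber_pres J a 'X_i = fiber_class J 'X_[a i].
Proof. exact: etrans (mmapX _ (fiber_constr J) _) (mmap1U _ _). Qed.

End FiberFacts.

Lemma mpoly_rmorph_eq (k : fieldType) (m : nat) (A : comNzRingType)
    (f g : {rmorphism {mpoly k[m]} -> A}) :
  (forall c, f c%:MP = g c%:MP) -> (forall i, f 'X_i = g 'X_i) -> f =1 g.
Proof.
move=> fgC fgX; elim/mpolyind => [|c a p _ _ e]; first by rewrite !rmorph0.
rewrite !rmorphD e -mul_mpolyC !rmorphM fgC mpolyXE_id !rmorph_prod.
by congr (_ * _ + _); apply: eq_bigr => i _; rewrite !rmorphXn fgX.
Qed.

(** * The fiber ring of I retracts onto the fiber ring of I_v *)

Lemma sub_ideal_closure (R : comNzRingType) (J : set R) f : J f -> ideal_closure J f.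
Proof.
move=> Jf; exists 1%N, (fun i => if i == 1%N then - f else 0); split.
  move=> i; case: eqP => [->|_]; last exact: ideal_exp_mem0.
  by rewrite -mulrN1; apply: ideal_mul_mem.
by rewrite big_nat1 /= subnn expr0 mulr1 expr1 subrr.
Qed.

Lemma in_rees_closure (R : comNzRingType) (J : set R) (p : {poly R}) :
  p \in in_rees J -> p \in in_closure J.
Proof. by move=> /in_reesP Jp; apply/in_closureP => j; apply: sub_ideal_closure. Qed.

(** Locked, so that the values of two polynomials are never compared by unfolding
    the field of fractions. *)
HB.lock Definition value (k : fieldType) (n : nat)
  (v : {fraction {poly {mpoly k[n]}}} -> int) (f : {mpoly k[n]}) : int :=
  v (in_frac f%:P).
Arguments value {k n} v f.

Section ValuationFacts.
Variables (k : fieldType) (n : nat) (I : set {mpoly k[n]}).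
Variable v : {fraction {poly {mpoly k[n]}}} -> int.
Implicit Types f g : {mpoly k[n]}.

Local Notation value := (value v).

Lemma attains_minE f : attains_min I v f <->
  [/\ I f, f != 0 & forall g, I g -> g != 0 -> value f <= value g].
Proof. by rewrite value.unlock. Qed.

Hypothesis Iv : rees_valuation I v.

Lemma in_fracC_neq0 f : f != 0 -> in_frac f%:P != 0.
Proof. by rewrite in_frac_eq0 polyC_eq0. Qed.

Lemma valueM f g : f != 0 -> g != 0 -> value (f * g) = value f + value g.
Proof.
case: Iv => -[_ vM _ _] _ /in_fracC_neq0 f0 /in_fracC_neq0 g0.
have e : in_frac (f * g)%:P = in_frac f%:P * in_frac g%:P by rewrite polyCM in_fracM.
by rewrite !value.unlock e; exact: vM f0 g0.
Qed.

Lemma valueD f g : f != 0 -> g != 0 -> f + g != 0 ->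
  Num.min (value f) (value g) <= value (f + g).
Proof.
case: Iv => -[_ _ vD _] _ /in_fracC_neq0 f0 /in_fracC_neq0 g0 /in_fracC_neq0.
have e : in_frac (f + g)%:P = in_frac f%:P + in_frac g%:P by rewrite polyCD in_fracD.
by rewrite !value.unlock e; exact: vD f0 g0.
Qed.

Lemma value_ge0 f : f != 0 -> 0 <= value f.
Proof.
case: Iv => -[v0 _ _ _] [Q [[pQ _] _] vQ] f0.
have f_cl : f%:P \in in_closure I by apply/in_rees_closure/rees_const_mem.
have : localization I Q (in_frac f%:P).
  exists (ReesClosure f_cl), 1; split; first by case: pQ.
  by rewrite rmorph1 /in_frac tofrac1 divr1.
by rewrite value.unlock -vQ => -[/eqP|//]; rewrite (negPf (in_fracC_neq0 f0)).
Qed.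

Lemma value_ideal (d : int) : is_ideal [set f | f != 0 -> d <= value f].
Proof.
split=> /= [|f g df dg fg0|c f df cf0]; first by rewrite eqxx.
- have [f0|f0] := eqVneq f 0; first by move: fg0; rewrite f0 add0r => /dg.
  have [g0|g0] := eqVneq g 0; first by move: fg0; rewrite g0 addr0 => /df.
  apply: le_trans (valueD f0 g0 fg0).
  by rewrite le_min (df f0) (dg g0).
- have [c0 f0] : c != 0 /\ f != 0 by apply/andP; rewrite -negb_or -mulf_eq0.
  rewrite (valueM c0 f0) -[d]add0r.
  by apply: lerD; [apply: value_ge0|apply: df].
Qed.

Lemma mpolyX_neq0 (a : 'X_{1..n}) : 'X_[k, a] != 0.
Proof. by rewrite -msupp_eq0 msuppX. Qed.

Lemma valueXD (a b : 'X_{1..n}) : value 'X_[a + b] = value 'X_[a] + value 'X_[b].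
Proof. by rewrite mpolyXD; exact: valueM (mpolyX_neq0 a) (mpolyX_neq0 b). Qed.

Lemma valueX_ge0 (a : 'X_{1..n}) : 0 <= value 'X_[a].
Proof. exact: value_ge0 (mpolyX_neq0 a). Qed.

Lemma valueX_le (a b : 'X_{1..n}) : (a <= b)%MM -> value 'X_[a] <= value 'X_[b].
Proof. by move=> ab; rewrite -(submK ab) valueXD lerDr; exact: valueX_ge0. Qed.

End ValuationFacts.

Section ReesRetraction.
Variables (k : fieldType) (n : nat) (I : set {mpoly k[n]}).
Hypotheses (I_monomial : monomial_ideal I) (I_neq0 : I <> [set 0]).
Variable v : {fraction {poly {mpoly k[n]}}} -> int.
Hypothesis Iv : rees_valuation I v.
Local Notation Iv' := (min_part I v).
Local Notation vX a := (value v 'X_[k, a]).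

Lemma ngens_gt0 : (0 < ngens I)%N.
Proof.
rewrite lt0n; apply/eqP => n0; apply: I_neq0.
rewrite (ideal_gen_gens I_monomial) (_ : [set _ | _ in _] = set0).
  apply/seteqP; split=> [|_ ->]; last by case: (@ideal_gen_ideal {mpoly k[n]} set0).
  by apply: ideal_gen_min => //; split=> [//|x y -> ->|c x ->]; rewrite ?addr0 ?mulr0.
apply/seteqP; split=> // f [a [j _ _] _].
by have : (j < 0)%N by rewrite -[X in (_ < X)%N]n0.
Qed.

(** The minimum of [v] over all of [I] is attained at a monomial generator, since
    [v] is nonnegative on polynomials and satisfies the ultrametric inequality. *)
Lemma exists_valuation_min : exists d : int,
  (forall a, I 'X_[a] -> d <= vX a) /\
  (forall a, I 'X_[a] -> attains_min I v 'X_[a] <-> vX a = d).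
Proof.
have [j0 _ j0min] := @arg_minP _ _ _ (Ordinal ngens_gt0) xpredT (fun j => value v 'X_[gen I j]) isT.
have d_le a : I 'X_[a] -> vX (gen I j0) <= vX a.
  by move=> /gen_below[j /(valueX_le Iv)]; apply: le_trans; apply: j0min.
exists (vX (gen I j0)); split; first exact: d_le.
move=> a Ia; rewrite attains_minE; split=> [[_ _ amin]|ea].
  apply/le_anti/andP; split; last exact: d_le.
  exact: amin (gen_mem _) (mpolyX_neq0 _ _).
split; [exact: Ia|exact: mpolyX_neq0|].
rewrite ea {1}(ideal_gen_gens I_monomial).
apply: (ideal_gen_min (value_ideal Iv _)) => _ [_ [j _ <-] <-] _.
exact: j0min.
Qed.

Lemma in_min_gens j : (j \in min_gens I v) <-> attains_min I v 'X_[gen I j].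
Proof. by rewrite inE; split=> /asboolP. Qed.

Lemma min_part_gens :
  Iv' = ideal_gen [set 'X_[k, a] | a in range (min_gen I v)].
Proof.
have [d [d_le d_eq]] := exists_valuation_min.
apply/seteqP; split; apply: (ideal_gen_min (ideal_gen_ideal _)) => f [a].
  move=> amin <-; have [Ia _ _] := amin; have [j ja] := gen_below Ia.
  have jmin : j \in min_gens I v.
    apply/in_min_gens/d_eq; first exact: gen_mem.
    apply/le_anti/andP; split; last exact: d_le (gen_mem _).
    by rewrite -((d_eq a Ia).1 amin); apply: (valueX_le Iv).
  apply: (mpolyX_mem (ideal_gen_ideal _) ja); apply: sub_ideal_gen.
  exists (gen I j) => //; exists (enum_rank_in jmin j) => //.
  by rewrite /min_gen enum_rankK_in.
move=> [i _ <-] <-; apply: sub_ideal_gen; exists (min_gen I v i); last by [].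
exact: (in_min_gens _).1 (enum_valP i).
Qed.

Lemma min_part_sub : Iv' `<=` I.
Proof.
apply: (ideal_gen_min (monomial_ideal_is_ideal I_monomial)) => _ [a + <-].
by case.
Qed.

Lemma in_rees_min_part p : p \in in_rees Iv' -> p \in in_rees I.
Proof.
move=> /in_reesP Jp; apply/in_reesP => j.
exact: (ideal_exp_sub min_part_sub).
Qed.

(** Keeping the monomials [x^a t^s] with [v (x^a) = s * v I] is multiplicative on
    the Rees ring, because all the others have [v (x^a) > s * v I]. *)
Lemma exists_truncation : exists h : {rmorphism rees I -> rees Iv'},
  [/\ forall i, irrelevant Iv' (h (to_rees I ('X_i)%:P)),
      forall c, h (to_rees I (c%:MP)%:P) = to_rees Iv' (c%:MP)%:P,
      forall j, j \in min_gens I v ->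
        h (to_rees I ('X_[gen I j] *: 'X)) = to_rees Iv' ('X_[gen I j] *: 'X)
    & forall j, j \notin min_gens I v -> h (to_rees I ('X_[gen I j] *: 'X)) = 0].
Proof.
have [d [d_le d_eq]] := exists_valuation_min.
pose w a s := vX a - d *+ s.
have wD a b s r : w (a + b)%MM (s + r)%N = w a s + w b r.
  by rewrite /w (valueXD Iv) mulrnDr; lia.
have eX (f : {mpoly k[n]}) : f *: 'X = f *: 'X^1 by rewrite expr1.
have w0 : w 0%MM 0%N = 0 by apply: weight0.
have core p : p \in in_rees I -> fil w 0 p /\ part w 0 p \in in_rees Iv'.
  rewrite {1}(ideal_gen_gens I_monomial); move: p; apply: rees_ind.
  - move=> p q [fp Ip] [fq Iq]; rewrite partD rpredD //; split=> //.
    exact: weights_inD.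
  - move=> p q [fp Ip] [fq Iq]; split.
      by rewrite -[0]addr0; apply: filM.
    by rewrite -[X in part _ X _]addr0 partM // rpredM.
  - move=> f; split=> [s a|].
      rewrite coefC; case: (s =P 0%N) => [-> _|]; last by rewrite mcoeff0 eqxx.
      by rewrite /w mulr0n subr0; exact: (valueX_ge0 Iv).
    have sz : (size (part w 0 f%:P) <= 1)%N.
      exact: leq_trans (size_poly _ _) (size_polyC_leq1 _).
    by rewrite (size1_polyC sz); apply: rees_const_mem.
  move=> _ [_ [j _ <-] <-]; rewrite eX -/(mono _ _ _); split.
    by apply/weights_in_mono; rewrite /w mulr1n subr_ge0; exact: d_le (gen_mem _).
  rewrite part_mono; case: ifP => [|_]; last exact: rpred0.
  rewrite /w mulr1n subr_eq0 => /eqP ej; rewrite /mono expr1.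
  apply: rees_deg1_mem; apply: sub_ideal_gen; exists (gen I j); last by [].
  by apply/(d_eq _ (gen_mem j)).
pose h (r : rees I) := to_rees Iv' (part w 0 (\val r)).
have hP (r : rees I) : fil w 0 (\val r) /\ part w 0 (\val r) \in in_rees Iv'.
  by apply: core; apply: (valP r).
have hB : {morph h : x y / x - y}.
  move=> x y; rewrite /h rmorphB partB to_reesB //; first by case: (hP x).
  by case: (hP y).
have hM : {morph h : x y / x * y}.
  move=> x y; have [[fx Ix] [fy Iy]] := (hP x, hP y).
  by rewrite /h rmorphM -[X in part _ X _]addr0 partM // to_reesM.
have h_mono a s : mono k a s \in in_rees I ->
    h (to_rees I (mono k a s)) = if w a s == 0 then to_rees Iv' (mono k a s) else 0.
  move=> Ias; rewrite /h to_reesK // part_mono.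
  by case: ifP => // _; apply: to_rees0.
have monoC : mono k (0%MM : 'X_{1..n}) 0 = 1 by rewrite /mono mpolyX0 scale1r.
have h1 : h 1 = 1.
  by rewrite -to_rees1 -monoC h_mono ?monoC ?rpred1 // w0 eqxx to_rees1.
exists (mk_rmorph hB hM h1) => /=.
have class_mono j : 'X_[gen I j] *: 'X = mono k (gen I j) 1 by [].
have I_mono j : mono k (gen I j) 1 \in in_rees I.
  by apply: rees_deg1_mem; apply: gen_mem.
have min_mono j : (w (gen I j) 1%N == 0) = (j \in min_gens I v).
  rewrite /w mulr1n subr_eq0; apply/eqP/idP => [e|/in_min_gens].
    by apply/in_min_gens/(d_eq _ (gen_mem j)).
  by move/(d_eq _ (gen_mem j)).
split=> [i|c|j jmin|j jout].
- have e : ('X_i)%:P = mono k U_(i)%MM 0 by rewrite /mono expr0 alg_polyC.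
  rewrite e h_mono -?e ?rees_const_mem //; case: ifP => _.
    by apply: sub_ideal_gen; exists i.
  by case: (@ideal_gen_ideal (rees Iv') (range (fun i => to_rees Iv' ('X_i)%:P))).
- rewrite /h to_reesK ?rees_const_mem // part_id // => s a.
  rewrite coefC; case: (s =P 0%N) => [->|]; last by rewrite mcoeff0 eqxx.
  rewrite mcoeffC; have [->|] := eqVneq a 0%MM; last by rewrite mulr0 eqxx.
  by rewrite w0.
- by rewrite class_mono h_mono // min_mono jmin.
- by rewrite class_mono h_mono // min_mono (negPf jout).
Qed.

Lemma exists_inclusion : exists h : {rmorphism rees Iv' -> rees I},
  [/\ forall r, h r = to_rees I (\val r),
      forall i, irrelevant I (h (to_rees Iv' ('X_i)%:P))
    & forall p, p \in in_rees Iv' -> h (to_rees Iv' p) = to_rees I p].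
Proof.
pose h (r : rees Iv') := to_rees I (\val r).
have hI (r : rees Iv') : \val r \in in_rees I.
  by apply: in_rees_min_part; apply: (valP r).
have hB : {morph h : x y / x - y} by move=> x y; rewrite /h rmorphB (to_reesB (hI x) (hI y)).
have hM : {morph h : x y / x * y}.
  by move=> x y; rewrite /h rmorphM (to_reesM (hI x) (hI y)).
have h1 : h 1 = 1 by rewrite /h rmorph1 to_rees1.
have hE p : p \in in_rees Iv' -> h (to_rees Iv' p) = to_rees I p.
  by move=> Jp; rewrite /h to_reesK.
exists (mk_rmorph hB hM h1); split=> //= i; rewrite hE ?rees_const_mem //.
by apply: sub_ideal_gen; exists i.
Qed.

Definition outer_gens : set (fiber I) :=
  [set fiber_class I 'X_[gen I j] | j in [set j | j \notin min_gens I v]].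

(** The truncation is the identity on the generators in the facet and kills the
    others; it descends to a retraction of the fiber rings. *)
Lemma exists_fiber_retraction : exists psi : {rmorphism fiber I -> fiber Iv'},
  [/\ cancel (fiber_incl Iv' I) psi,
      forall x, outer_gens x -> psi x = 0,
      forall z, ideal_gen outer_gens (z - fiber_incl Iv' I (psi z)),
      forall c, psi (fiber_const I c) = fiber_const Iv' c
    & forall j, j \in min_gens I v ->
        psi (fiber_class I 'X_[gen I j]) = fiber_class Iv' 'X_[gen I j]].
Proof.
have [h [hX hC hmin hout]] := exists_truncation.
have [g [gE gX gI]] := exists_inclusion.
pose psi := fiber_rmorph hX; pose emb := fiber_rmorph gX.
have embE : fiber_incl Iv' I =1 emb.
  by move=> z; rewrite /= /fiber_map gE.
have psiE r : psi (fiber_pi I r) = fiber_pi Iv' (h r) by apply: fiber_mapE.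
have emb_pi r : emb (fiber_pi Iv' r) = fiber_pi I (g r) by apply: fiber_mapE.
have psiC c : psi (fiber_const I c) = fiber_const Iv' c.
  by rewrite [LHS]psiE hC.
have embC c : emb (fiber_const Iv' c) = fiber_const I c.
  by rewrite [LHS]emb_pi gI // rees_const_mem.
have psi_min j : j \in min_gens I v ->
    psi (fiber_class I 'X_[gen I j]) = fiber_class Iv' 'X_[gen I j].
  by move=> jmin; rewrite [LHS]psiE hmin.
have psi_out j : j \notin min_gens I v -> psi (fiber_class I 'X_[gen I j]) = 0.
  by move=> jout; rewrite [LHS]psiE hout // rmorph0.
have emb_min j : j \in min_gens I v ->
    emb (fiber_class Iv' 'X_[gen I j]) = fiber_class I 'X_[gen I j].
  move=> jmin; rewrite [LHS]emb_pi gI //; apply: rees_deg1_mem.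
  by apply: sub_ideal_gen; exists (gen I j); [exact: (in_min_gens j).1 jmin|].
exists psi; split=> //.
- move=> z; rewrite embE; move: z.
  apply: (fiber_ind min_part_gens) => [y z ey ez|y z ey ez|c|_ [i _ <-]].
  + by rewrite !rmorphD ey ez.
  + by rewrite !rmorphM ey ez.
  + by rewrite embC psiC.
  + by rewrite /min_gen emb_min ?psi_min ?enum_valP.
- by move=> _ [j jout <-]; apply: psi_out.
move=> z; rewrite embE; have idL := ideal_gen_ideal outer_gens; move: z.
apply: (fiber_ind (ideal_gen_gens I_monomial)) => [y z Ly Lz|y z Ly Lz|c|_ [j _ <-]].
- exact: congruent_imageD Ly Lz.
- exact: congruent_imageM Ly Lz.
- by rewrite psiC embC subrr; case: idL.
have [jmin|jout] := boolP (j \in min_gens I v).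
  by rewrite psi_min // emb_min // subrr; case: idL.
by rewrite psi_out // rmorph0 subr0; apply: sub_ideal_gen; exists j.
Qed.

End ReesRetraction.

Arguments outer_gens {k n} I v.

(** The polynomial counterpart of the retraction of fiber rings: the variables
    outside [Y] are sent to zero. *)
Section VariableRetraction.
Variables (k : fieldType) (m : nat) (Y : {set 'I_m}).

Definition var_emb : {rmorphism {mpoly k[#|Y|]} -> {mpoly k[m]}} :=
  mmap (@mpolyC _ k) (fun j => 'X_(enum_val j)).

Definition var_proj : {rmorphism {mpoly k[m]} -> {mpoly k[#|Y|]}} :=
  mmap (@mpolyC _ k) (fun j => oapp (fun i => 'X_i) 0 [pick i | enum_val i == j]).

Definition outer_vars : set {mpoly k[m]} := [set 'X_j | j in [set j | j \notin Y]].

Lemma var_embX i : var_emb 'X_i = 'X_(enum_val i).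
Proof. by rewrite /= mmapX mmap1U. Qed.

Lemma var_projC c : var_proj c%:MP = c%:MP.
Proof. by rewrite /= mmapC. Qed.

Lemma var_projX i : var_proj 'X_(enum_val i) = 'X_i.
Proof.
rewrite /= mmapX mmap1U; case: pickP => [j /eqP/enum_val_inj -> //|/(_ i)].
by rewrite eqxx.
Qed.

Lemma var_proj_out j : j \notin Y -> var_proj 'X_j = 0.
Proof.
move=> jY; rewrite /= mmapX mmap1U; case: pickP => // i /eqP ij.
by rewrite -ij enum_valP in jY.
Qed.

Lemma var_embK : cancel var_emb var_proj.
Proof.
apply: (mpoly_rmorph_eq (f := var_proj \o var_emb) (g := idfun)) => [c|i] /=.
  by rewrite !mmapC.
by have := var_projX i; rewrite -var_embX.
Qed.

Lemma outer_vars_proj x : outer_vars x -> var_proj x = 0.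
Proof. by move=> [j jY <-]; apply: var_proj_out. Qed.

Lemma var_proj_retract z : ideal_gen outer_vars (z - var_emb (var_proj z)).
Proof.
have idL := ideal_gen_ideal outer_vars.
have LC c : ideal_gen outer_vars (c%:MP - var_emb (var_proj c%:MP)).
  by rewrite /= !mmapC subrr; case: idL.
elim/mpolyind: z => [|c a p _ _ Lp]; first by rewrite !rmorph0 subrr; case: idL.
apply: (congruent_imageD idL _ Lp).
rewrite -mul_mpolyC; apply: (congruent_imageM idL (LC c)).
rewrite mpolyXE_id; elim/big_ind: _ => [|y t|i _]; [|exact: congruent_imageM|].
  by have := LC 1; rewrite mpolyC1.
elim: (a i) => [|e IH]; first by have := LC 1; rewrite mpolyC1.
rewrite exprS; apply: (congruent_imageM idL _ IH).
have [iY|iY] := boolP (i \in Y); last first.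
  rewrite (var_proj_out iY) rmorph0 subr0; apply: sub_ideal_gen.
  by exists i; [exact: iY|].
have -> : i = enum_val (enum_rank_in iY i) by rewrite enum_rankK_in.
by rewrite var_projX var_embX subrr; case: idL.
Qed.

End VariableRetraction.

(** * Rees valuations from facets of the Newton cone *)

Section ExponentVectors.
Variable n : nat.
Implicit Types (a b : 'X_{1..n}) (s r : nat).

(** The exponent of [x^a t^s]; the degree in [t] comes first. *)
Definition expv a s : 'rV[int]_n.+1 :=
  \row_i (if unlift ord0 i is Some j then (a j)%:Z else s%:Z).

Lemma expv0E a s : expv a s 0 ord0 = s%:Z.
Proof. by rewrite mxE unlift_none. Qed.

Lemma expvSE a s j : expv a s 0 (lift ord0 j) = (a j)%:Z.
Proof. by rewrite mxE liftK. Qed.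

Lemma rowS_eq (x y : 'rV[int]_n.+1) : x 0 ord0 = y 0 ord0 ->
  (forall j, x 0 (lift ord0 j) = y 0 (lift ord0 j)) -> x = y.
Proof. by move=> e0 eS; apply/rowP => i; case: (unliftP ord0 i) => [j|] ->. Qed.

Lemma expvD a b s r : expv (a + b)%MM (s + r) = expv a s + expv b r.
Proof.
by apply: rowS_eq => [|j]; rewrite [RHS]mxE ?expv0E ?expvSE ?mnmDE PoszD.
Qed.

Lemma expv00 : expv 0%MM 0 = 0.
Proof. by apply: rowS_eq => [|j]; rewrite [RHS]mxE ?expv0E ?expvSE ?mnm0E. Qed.

Lemma expvMn a s m : expv a s *+ m = expv (a *+ m)%MM (s * m).
Proof.
elim: m => [|m IH]; first by rewrite mulr0n mulm0n muln0 expv00.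
by rewrite mulrS IH mulmS mulnS expvD.
Qed.

Lemma expv_inj a b s r : expv a s = expv b r -> a = b /\ s = r.
Proof.
move=> e; split; last by have := congr1 (fun x : 'rV_ _ => x 0 ord0) e; rewrite !expv0E => -[].
apply/mnmP => j; have := congr1 (fun x : 'rV_ _ => x 0 (lift ord0 j)) e.
by rewrite !expvSE => -[].
Qed.

Lemma expv_of (x : 'rV[int]_n.+1) : (forall i, 0 <= x 0 i) -> exists a s, x = expv a s.
Proof.
move=> x0; exists [multinom absz (x 0%R (lift ord0 j)) | j < n], (absz (x 0 ord0)).
by apply: rowS_eq => [|j]; rewrite ?expv0E ?expvSE ?mnmE gez0_abs.
Qed.

Lemma expv_sum (J : Type) (r : seq J) (D : pred J) (F : J -> 'X_{1..n}) :
  expv (\big[+%MM/0%MM]_(j <- r | D j) F j) (\sum_(j <- r | D j) 1) =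
  \sum_(j <- r | D j) expv (F j) 1.
Proof. by elim/big_rec3: _ => [|j x y z _ <-]; rewrite ?expv00 ?expvD. Qed.

End ExponentVectors.

Section ReesCone.
Variables (k : fieldType) (n : nat) (I : set {mpoly k[n]}).
Hypotheses (I_monomial : monomial_ideal I) (I_neq0 : I <> [set 0]).
Implicit Types (a b : 'X_{1..n}) (s r : nat).
Local Notation mono := (mono k).

Definition cone_gen (j : 'I_n + 'I_(ngens I)) : 'rV[int]_n.+1 :=
  match j with inl i => expv U_(i)%MM 0 | inr j => expv (gen I j) 1 end.

Lemma cone_gen_span u : (forall j, dot (cone_gen j) u = 0) -> u = 0.
Proof.
move=> u0.
have uS i : u 0 (lift ord0 i) = 0.
  rewrite -(u0 (inl i)) /dot /= big_ord_recl expv0E mul0r add0r (bigD1 i) //=.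
  rewrite expvSE mnm1E eqxx mul1r big1 ?addr0 // => j ji.
  by rewrite expvSE mnm1E eq_sym (negPf ji) mul0r.
apply: rowS_eq => [|j]; last by rewrite uS mxE.
have := u0 (inr (Ordinal (ngens_gt0 I_monomial I_neq0))).
rewrite /dot /= big_ord_recl expv0E mul1r big1 ?addr0 => [->|i _]; first by rewrite mxE.
by rewrite uS mulr0.
Qed.

Lemma cone_rees (x : 'rV[int]_n.+1) : natspan (range cone_gen) x ->
  exists a s, x = expv a s /\ ideal_exp I s 'X_[a].
Proof.
move: x; apply: natspan_min.
  split=> [|_ _ [a [s [-> Ia]]] [b [r [-> Ib]]]].
    by exists 0%MM, 0%N; rewrite expv00.
  by exists (a + b)%MM, (s + r)%N; rewrite expvD mpolyXD; split=> //; exact: ideal_expM.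
move=> _ [[i|j] _ <-]; first by exists U_(i)%MM, 0%N.
exists (gen I j), 1%N; split=> //; rewrite -['X_[_]]mulr1.
by apply: ideal_mul_mem; first exact: gen_mem.
Qed.

Lemma mono_closure a s : ideal_closure (ideal_exp I s) 'X_[a] ->
  mono a s \in in_closure I.
Proof.
move=> Ia; apply/in_closureP => j; rewrite coefZ coefXn; case: eqP => [->|_].
  by rewrite mulr1.
by rewrite mulr0; apply/sub_ideal_closure/ideal_exp_mem0.
Qed.

(** Some power of a lattice point of the cone comes from the Rees ring, so the
    point is the exponent of an integral monomial. *)
Lemma cone_closure m N : (0 < N)%N -> natspan (range cone_gen) (m *+ N) ->
  exists a s, m = expv a s /\ mono a s \in in_closure I.
Proof.
move=> N0 /cone_rees[b [r [e Ib]]].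
have [i|a [s em]] := @expv_of n m.
  have := congr1 (fun x : 'rV_ _ => x 0 i) e; rewrite mulmxnE.
  rewrite -(pmulrn_lge0 _ N0) => ->; rewrite mxE.
  by case: (unlift ord0 i).
exists a, s; split=> //; apply: mono_closure.
move: e; rewrite em expvMn => /expv_inj[eb er].
exists N, (fun i => if i == N then - 'X_[a] ^+ N else 0); split=> [i|].
  case: eqP => [->|_]; last exact: ideal_exp_mem0.
  rewrite ideal_exp_exp er mpolyXn eb.
  by apply: ideal_opp => //; apply: ideal_exp_ideal.
rewrite big_nat_recr //= eqxx subnn expr0 mulr1 big_nat big1 ?add0r ?subrr //.
by move=> i /andP[_ iN]; rewrite ltn_eqF // mul0r.
Qed.

End ReesCone.

Section FacetValuation.
Variables (k : fieldType) (n : nat) (I : set {mpoly k[n]}).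
Hypotheses (I_monomial : monomial_ideal I) (I_neq0 : I <> [set 0]).
Variable l : 'rV[int]_n.+1.
Local Notation t := (expv (0%MM : 'X_{1..n}) 1).
Hypothesis l_facet : facet (cone_gen (I := I)) t l.
Variable m1 : 'rV[int]_n.+1.
Hypothesis m1_l : dot m1 l = 1.
Implicit Types (a b : 'X_{1..n}) (s r : nat) (p q : {poly {mpoly k[n]}}).
Local Notation mono := (mono k).

(** The monomial valuation of the facet: [l] lists minus [v I], in the place of
    [t], and the [v x_i]. *)
Definition facet_weight a s : int := dot (expv a s) l.
Local Notation w := facet_weight.

Lemma facet_weightD a b s r : w (a + b)%MM (s + r)%N = w a s + w b r.
Proof. by rewrite /w expvD dotDl. Qed.
Local Notation wD := facet_weightD.

Lemma facet_weight_t : w 0%MM 1 < 0.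
Proof. by case: l_facet. Qed.

Lemma facet_weight_gen (j : 'I_(ngens I)) : 0 <= w (gen I j) 1.
Proof. by case: l_facet => /(_ (inr j)). Qed.

Lemma facet_weight_x a : 0 <= w a 0.
Proof.
rewrite (multinomUE_id a).
apply: (big_ind (fun b => 0 <= w b 0)) => [|b c b0 c0|i _].
- by rewrite /w expv00 dot0l.
- by rewrite -[0%N]addn0 wD addr_ge0.
by rewrite -[X in w _ X](mul0n (a i)) (weightMn wD) mulrn_wge0 //;
  case: l_facet => /(_ (inl i)).
Qed.

Definition facet_sum := \sum_(j | dot (cone_gen (I := I) j) l == 0) cone_gen j.

Lemma facet_sum_l : dot facet_sum l = 0.
Proof. by rewrite dot_suml big1 // => j /eqP. Qed.

Lemma facet_closure m : 0 <= dot m l -> exists c a s,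
  m + facet_sum *+ c = expv a s /\ mono a s \in in_closure I.
Proof.
have gs := cone_gen_span I_monomial I_neq0.
move=> /(facet_translate gs l_facet)[N [c [N0 /(cone_closure N0)[a [s [e as_cl]]]]]].
by exists c, a, s.
Qed.

Lemma exists_weight_ge0 (x : int) : 0 <= x -> exists a s, w a s = x.
Proof.
move=> x0; have [|c [a [s [e _]]]] := @facet_closure (x *: m1).
  by rewrite dotZl m1_l mulr1.
exists a, s; rewrite /w -e dotDl dotMnl facet_sum_l mul0rn addr0.
by rewrite dotZl m1_l mulr1.
Qed.

(** Since [t] has negative weight, negative integers are reached as well, by
    monomials with nonnegative exponents. *)
Lemma exists_weight (x : int) : exists a s, w a s = x.
Proof.
have [x0|x0] := leP 0 x; first exact: exists_weight_ge0.
have := facet_weight_t => t0.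
have wt : w (0%MM *+ (absz x))%MM (1 * (absz x)) = x * - w 0%MM 1%N.
  by rewrite (weightMn wD) -mulr_natl natz ltz0_abs // mulrN mulNr.
have [|a [s e]] := @exists_weight_ge0 (x * (1 + w 0%MM 1%N)).
  by rewrite mulr_le0 ?(ltW x0) // addrC lezD1.
exists (a + 0%MM *+ (absz x))%MM, (s + 1 * (absz x))%N; rewrite wD e wt.
by rewrite -mulrDr addrK mulr1.
Qed.

Lemma fil_rees p : p \in in_rees I -> fil w 0 p.
Proof.
rewrite (ideal_gen_gens I_monomial); move: p; apply: rees_ind => [p q|p q|c|].
- exact: weights_inD.
- by move=> fp fq; rewrite -[0]addr0; apply: (filM wD).
- move=> s a; rewrite coefC; case: (s =P 0%N) => [-> _|_]; first exact: facet_weight_x.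
  by rewrite mcoeff0 eqxx.
move=> _ [_ [j _ <-] <-]; rewrite (_ : _ *: 'X = mono (gen I j) 1) //.
by apply/weights_in_mono; exact: facet_weight_gen.
Qed.

(** If [f t^i] had negative weight [e], all the terms of an integral equation of
    degree [m] except the leading one would have weight greater than [m e]. *)
Lemma fil_closure p : p \in in_closure I -> fil w 0 p.
Proof.
move=> /in_closureP Ip; rewrite -[p]coefK poly_def.
elim/big_ind: _ => [||i _]; [exact: weights_in0|move=> ? ?; exact: weights_inD|].
have [f0|p0] := eqVneq (p`_i *: 'X^i) 0; first by rewrite f0; apply: weights_in0.
set f := _ *: _ in p0 *; apply/(weight_orderP w _ p0); rewrite leNgt; apply/negP => f_lt0.
have [m [c [cI e]]] := Ip i.
have {}e : f ^+ m = - \sum_(1 <= j < m.+1) (c j *: 'X^(i * j)) * f ^+ (m - j).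
  apply/eqP; rewrite -addr_eq0 /f exprZn -exprM; apply/eqP.
  rewrite big_nat (eq_bigr (fun j => (c j * p`_i ^+ (m - j)) *: 'X^(i * m))) => [|j /andP[_ jm]].
    by rewrite -big_nat -scaler_suml -scalerDl e scale0r.
  rewrite exprZn -exprM -scalerAl -scalerAr scalerA -exprD -mulnDr subnKC //.
have : fil w (weight_order w f *+ m + 1) (f ^+ m).
  rewrite e; apply: weights_inN; rewrite big_nat.
  elim/big_ind: _ => [||j /andP[j0 jm]]; [exact: weights_in0|move=> ? ?; exact: weights_inD|].
  have fc : fil w 0 (c j *: 'X^(i * j)).
    by apply/fil_rees/in_rees_mono; rewrite -ideal_exp_exp.
  have ff : fil w (weight_order w f *+ (m - j)) (f ^+ (m - j)).
    by apply: (fil_exp wD); apply/(weight_orderP w _ p0).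
  apply: fil_le (filM wD fc ff); rewrite add0r -[X in _ *+ X + _ <= _](subnK (n := m) (m := j)) //.
  rewrite mulrnDr -addrA gerDl -[weight_order w f]opprK mulNrn.
  have : 1 <= (- weight_order w f) *+ j.
    by rewrite -mulr_natl natz; have : 1 <= j%:Z by []; move: f_lt0; set x := weight_order w f; nia.
  lia.
have fm0 : f ^+ m != 0 by rewrite expf_neq0.
move/(weight_orderP w _ fm0); rewrite (_ : weight_order w (f ^+ m) = weight_order w f *+ m); first lia.
elim: (m) => [|m' IH].
  rewrite expr0 mulr0n (_ : 1 = mono 0%MM 0); last by rewrite /mono mpolyX0 scale1r.
  by rewrite weight_order_mono (weight0 wD).
by rewrite exprS mulrS (weight_orderM wD) ?expf_neq0 // IH.
Qed.

(** Multiplying by a monomial interior to the facet makes integral any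
    polynomial of nonnegative weight. *)
Lemma fil_closure_translate : exists a0 s0, [/\ w a0 s0 = 0,
  mono a0 s0 \in in_closure I
  & forall p, fil w 0 p -> exists c, mono a0 s0 ^+ c * p \in in_closure I].
Proof.
have [a0 [s0 [e0 as0_cl]]] : exists a s, facet_sum = expv a s /\ mono a s \in in_closure I.
  apply: (@cone_closure _ _ _ _ 1%N) => //; rewrite mulr1n; apply: natspan_sum => j _.
  by apply: sub_natspan; exists j.
exists a0, s0; split=> //; first by rewrite /w -e0 facet_sum_l.
have cl_sum p q : (exists c, mono a0 s0 ^+ c * p \in in_closure I) ->
    (exists c, mono a0 s0 ^+ c * q \in in_closure I) ->
    exists c, mono a0 s0 ^+ c * (p + q) \in in_closure I.
  move=> [c cp] [d dq]; exists (c + d)%N; rewrite exprD mulrDr.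
  rewrite {1}[_ ^+ c * _]mulrC -!mulrA.
  by rewrite (rpredD (rpredM (rpredX d as0_cl) cp) (rpredM (rpredX c as0_cl) dq)).
have cl0 : exists c, mono a0 s0 ^+ c * 0 \in in_closure I.
  by exists 0%N; rewrite mulr0 rpred0.
move=> p fp; rewrite -[p]coefK poly_def.
elim/big_ind: _ => [||s _]; [exact: cl0|exact: cl_sum|].
rewrite {1}[p`_s]mpolyE scaler_suml big_seq.
elim/big_ind: _ => [||a]; [exact: cl0|exact: cl_sum|rewrite mcoeff_msupp => /fp].
move=> /facet_closure[c [b [r [e br_cl]]]]; exists c.
have -> : mono a0 s0 ^+ c * (((p`_s)@_a *: 'X_[a]) *: 'X^s) =
    ((p`_s)@_a)%:MP%:P * mono b r.
  have [-> ->] : b = (a + a0 *+ c)%MM /\ r = (s + s0 * c)%N.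
    by apply: expv_inj; rewrite expvD -expvMn -e e0.
  rewrite monoXn mulrC -monoM -mul_mpolyC -scalerA -mul_polyC -/(mono _ _).
  by rewrite mulrA.
by apply: rpredM br_cl; apply/in_rees_closure/rees_const_mem.
Qed.

(** The center of the valuation of the facet on the integral closure of the Rees
    ring. *)
Definition center : set (rees_closure I) := [set r | fil w 1 (\val r)].

Lemma fil_val (r : rees_closure I) : fil w 0 (\val r).
Proof. by apply: fil_closure; apply: (valP r). Qed.

Lemma not_center (r : rees_closure I) : ~ center r -> \val r != 0 /\ weight_order w (\val r) = 0.
Proof.
move=> nr; have nr' : ~ fil w (0 + 1) (\val r) by rewrite add0r.
split; last exact: weight_order_eq (@fil_val r) nr'.
by apply/eqP => r0; apply: nr; rewrite /center /= r0; apply: weights_in0.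
Qed.

Lemma center_prime : prime_ideal center.
Proof.
split; first split.
- by rewrite /center /mkset rmorph0; apply: weights_in0.
- by move=> x y cx cy; rewrite /center /mkset rmorphD; apply: weights_inD.
- move=> c x cx; rewrite /center /mkset rmorphM -[1]add0r.
  exact: (filM wD (@fil_val c) cx).
- rewrite /center /mkset rmorph1 (_ : 1 = mono 0%MM 0); last by rewrite /mono mpolyX0 scale1r.
  by move/weights_in_mono; rewrite (weight0 wD).
move=> x y; rewrite /center /mkset rmorphM => fxy; apply: contrapT.
move=> /not_orP[/not_center[x0 ox] /not_center[y0 oy]].
have xy0 : \val x * \val y != 0 by rewrite mulf_neq0.
by move: fxy => /(weight_orderP w _ xy0); rewrite (weight_orderM wD) // ox oy.
Qed.

Lemma fil_ideal (f : {mpoly k[n]}) : I f -> fil w (- w 0%MM 1) f%:P.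
Proof.
move=> If; have fX : fil w 0 (f *: 'X) by apply/fil_rees/rees_deg1_mem.
move=> s a; rewrite coefC; case: (s =P 0%N) => [-> fa|_]; last by rewrite mcoeff0 eqxx.
have := fX 1%N a; rewrite coefZ coefX mulr1 => /(_ fa).
have -> : w a 1%N = w 0%MM 1%N + w a 0 by rewrite -wD add0m addn0.
by rewrite -lerBlDl sub0r.
Qed.

Lemma extended_ideal_center : extended_ideal I `<=` center.
Proof.
apply: ideal_gen_min; first by case: center_prime.
move=> r [f If rf]; rewrite /center /= rf; apply: fil_le (fil_ideal If).
by have := facet_weight_t; lia.
Qed.

Local Notation v := (frac_order w).

(** A fraction of nonnegative value becomes a quotient of two integral elements,
    with a denominator of value zero, once numerator and denominator are
    multiplied by a suitable monomial. *)
Lemma facet_valuation_ring : valuation_ring v = localization I center.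
Proof.
have pC := center_prime; apply/seteqP; split=> z; last first.
  move=> [a [b [/not_center[b0 ob] ->]]].
  have [a0|a0] := eqVneq (\val a) 0.
    by left; rewrite a0 /in_frac tofrac0 mul0r.
  by right; rewrite (frac_orderE wD a0 b0) ob subr0; apply/(weight_orderP w _ a0)/fil_val.
have [p [q [q0 ->]]] := frac_numden z; rewrite -!/(in_frac _).
have [->|p0] := eqVneq p 0.
  move=> _; exists 0, 1; split; first by case: pC.
  by rewrite rmorph0 /in_frac tofrac0 !mul0r.
case=> [/eqP|].
  by rewrite mulf_eq0 invr_eq0 !in_frac_eq0 (negPf p0) (negPf q0).
rewrite (frac_orderE wD p0 q0) subr_ge0 => qp.
have [a [s was]] := exists_weight (- weight_order w q).
have [a0 [s0 [w0 cl0 tr]]] := fil_closure_translate.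
have fqp x : x != 0 -> weight_order w q <= weight_order w x -> fil w 0 (mono a s * x).
  move=> x0 qx; rewrite -(subrr (weight_order w q)) addrC.
  by apply: (filM wD); [apply/weights_in_mono; rewrite was|apply/(weight_orderP w _ x0)].
have [c cp] := tr _ (fqp _ p0 qp); have [d dq] := tr _ (fqp _ q0 (lexx _)).
pose u := mono a0 s0 ^+ (c + d) * mono a s.
have u0 : u != 0 by rewrite mulf_neq0 ?expf_neq0 // mono_neq0.
have up : u * p \in in_closure I.
  by rewrite /u addnC exprD -!mulrA; exact: rpredM (rpredX d cl0) cp.
have uq : u * q \in in_closure I.
  by rewrite /u exprD -!mulrA; exact: rpredM (rpredX c cl0) dq.
have uq_order : weight_order w (u * q) = 0.
  rewrite (weight_orderM wD) // (weight_orderM wD) ?expf_neq0 ?mono_neq0 // monoXn !weight_order_mono.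
  by rewrite (weightMn wD) w0 mul0rn was add0r addNr.
exists (ReesClosure up), (ReesClosure uq); split.
  rewrite /center /= => /(weight_orderP w _ (mulf_neq0 u0 q0)).
  by rewrite uq_order.
have iu0 : in_frac u != 0 by rewrite in_frac_eq0; exact: u0.
change (in_frac p / in_frac q = in_frac (u * p) / in_frac (u * q)).
have := mulf_div (in_frac u) (in_frac u) (in_frac p) (in_frac q).
by rewrite (divff iu0) mul1r !in_fracM.
Qed.

(** The center is minimal over the extension of [I] because its localization is a
    discrete valuation ring: for [f] in [I], a power of any [b] in the center is
    divisible by [f] in the localization. *)
Lemma facet_rees_valuation : rees_valuation I v.
Proof.
have pC := center_prime.
split; first exact: (frac_order_valuation k wD (exists_weight 1)).
exists center; last exact: facet_valuation_ring.
split; first by split; [exact: center_prime|exact: extended_ideal_center].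
move=> Q [pQ IQ] QC; apply/seteqP; split=> // b Cb.
have [f [If f0]] : exists f, I f /\ f != 0.
  exists 'X_[gen I (Ordinal (ngens_gt0 I_monomial I_neq0))].
  by split; [exact: gen_mem|exact: mpolyX_neq0].
have f_cl : f%:P \in in_closure I by apply/in_rees_closure/rees_const_mem.
have Qf : Q (ReesClosure f_cl) by apply: IQ; apply: sub_ideal_gen; exists f.
have fP0 : f%:P != 0 by rewrite polyC_eq0.
have [b0|b0] := eqVneq (\val b) 0.
  have -> : b = 0 by apply: val_inj; rewrite b0 rmorph0.
  by case: pQ => -[].
pose M := absz (weight_order w f%:P).
apply: (prime_ideal_exp (m := M) pQ).
have bM0 : \val b ^+ M != 0 by rewrite expf_neq0.
have fM : fil w M (\val b ^+ M).
  by rewrite -[M%:Z]mulr1n -natz -mulr_natl mulr1n mulr_natl; apply: (fil_exp wD).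
have : valuation_ring v (in_frac (\val b ^+ M) / in_frac f%:P).
  right; rewrite (frac_orderE wD bM0 fP0) subr_ge0.
  apply: le_trans (_ : M%:Z <= _); first by rewrite abszE ler_norm.
  exact/(weight_orderP w _ bM0).
rewrite facet_valuation_ring => -[x [y [Cy /eqP]]].
have [y0 _] := not_center Cy.
rewrite eqr_div ?in_frac_eq0 // -!in_fracM => /eqP/in_frac_inj e.
have [[_ _ QM] _ Qp] := pQ.
have /Qp[//|/QC//] : Q (b ^+ M * y).
rewrite (_ : b ^+ M * y = x * ReesClosure f_cl); first exact: QM.
by apply: val_inj; rewrite !rmorphM rmorphXn.
Qed.

Lemma facet_attains_min (j : 'I_(ngens I)) : w (gen I j) 1 = 0 ->
  attains_min I v 'X_[gen I j].
Proof.
move=> wj; split; [exact: gen_mem|exact: mpolyX_neq0|move=> f If f0].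
have fP0 : f%:P != 0 by rewrite polyC_eq0.
have XP0 : ('X_[k, gen I j])%:P != 0 by rewrite polyC_eq0 mpolyX_neq0.
rewrite [leRHS](frac_order_poly wD fP0) [leLHS](frac_order_poly wD XP0).
have -> : ('X_[k, gen I j])%:P = mono (gen I j) 0 by rewrite /mono expr0 alg_polyC.
rewrite weight_order_mono; apply: le_trans (_ : - w 0%MM 1%N <= _).
  by rewrite -subr_le0 opprK -wD addm0 add0n wj.
exact/(weight_orderP w _ fP0)/fil_ideal.
Qed.

End FacetValuation.

(** The hypothesis says that the direction of [t] is outside the cone spanned by
    the exponents of the Rees ring and by the opposite of the exponent of the
    product over [T]. So Farkas' lemma gives a hyperplane supporting the cone
    along the exponents of [T], which is then tilted into a facet. *)
Lemma exists_rees_valuation (k : fieldType) (n : nat) (I : set {mpoly k[n]})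
    (T : {set 'I_(ngens I)}) :
  monomial_ideal I -> I <> [set 0] ->
  (forall M N, (0 < N)%N ->
    ~ ideal_exp I (N + #|T| * M) 'X_[(\big[+%MM/0%MM]_(j in T) gen I j) *+ M]) ->
  exists2 v, rees_valuation I v & forall j, j \in T -> attains_min I v 'X_[gen I j].
Proof.
move=> mI I0 noT; pose g := cone_gen (I := I); have gs := cone_gen_span mI I0.
pose t := expv (0%MM : 'X_{1..n}) 1.
pose W := \sum_(j in T) g (inr j).
have WE : W = expv (\big[+%MM/0%MM]_(j in T) gen I j) #|T|.
  by rewrite /W -expv_sum sum1_card.
have [[N N0 /natspan_cons_opp[M /cone_rees[a [s [e Ia]]]]]|[u gu tu]] :=
    farkas (- W :: codom g) t.
  case: (noT M N N0); move: e Ia; rewrite WE /t !expvMn -expvD => /expv_inj[<- <-].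
  by rewrite mul1n (_ : (0 *+ N)%MM = 0%MM) ?add0m //; apply/mnmP => i; rewrite mulmnE mnm0E.
have gu0 j : 0 <= dot (g j) u.
  by apply: gu; rewrite in_cons; apply/orP; right; exact: codom_f.
have Tu j : j \in T -> dot (g (inr j)) u = 0.
  move=> jT; have : \sum_(j in T) dot (g (inr j)) u = 0.
    apply/eqP; rewrite eq_le sumr_ge0 ?andbT // -dot_suml -/W -oppr_ge0 -dotNl.
    by apply: gu; rewrite inE eqxx.
  by move/psumr_eq0P; apply.
have [l1 fl1 Zl1] := exists_facet gs gu0 tu.
have [l [fl Zl [m1 ml]]] := facet_normalize fl1.
exists (frac_order (facet_weight l)); first exact: (facet_rees_valuation mI I0 fl ml).
by move=> j /Tu/Zl1/Zl wj; exact: (facet_attains_min mI fl).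
Qed.

(** A prime of the fiber ring contains the generators outside the facet of a
    suitable Rees valuation: the product of the generators not in the prime is
    not nilpotent. *)
Lemma prime_contains_outer (k : fieldType) (n : nat) (I : set {mpoly k[n]})
    (P : set (fiber I)) :
  monomial_ideal I -> I <> [set 0] -> I <> setT -> prime_ideal P ->
  exists2 v, rees_valuation I v & outer_gens I v `<=` P.
Proof.
move=> mI I0 I1 pP.
pose T : {set 'I_(ngens I)} := [set j | `[< ~ P (fiber_class I 'X_[gen I j]) >]]%SET.
have TP j : reflect (~ P (fiber_class I 'X_[gen I j])) (j \in T).
  by rewrite inE; apply: asboolP.
have [|v Iv Tv] := exists_rees_valuation (T := T) mI I0; last first.
  exists v => // _ [j jout <-]; apply: contrapT => /TP/Tv jmin.
  by move/negP: jout; apply; apply/in_min_gens.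
move=> M N N0 Ia; set a := \big[_/_]_(_ in _) _ in Ia.
have aT : \prod_(j in T) mono k (gen I j) 1 = mono k a #|T| by rewrite mono_prod sum1_card.
have aM : (\prod_(j in T) mono k (gen I j) 1) ^+ M = 'X_[a *+ M] *: 'X^(#|T| * M).
  by rewrite aT monoXn.
have {}Ia : ideal_exp I (#|T| * M).+1 'X_[a *+ M].
  by apply: ideal_exp_leq Ia; rewrite -(prednK N0) addSn ltnS leq_addl.
have [_ irr] := ideal_expS_irrelevant (sub_maximal_ideal mI I1) Ia.
apply: (prime_ideal_prod (r := index_enum _) (D := mem T)
  (F := fun j => fiber_class I 'X_[gen I j]) pP) => [j /TP //|].
apply: (prime_ideal_nilpotent (m := M) pP).
pose r j := to_rees I ('X_[gen I j] *: 'X).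
rewrite (_ : \prod_(j in T) _ = fiber_pi I (\prod_(j in T) r j)); last first.
  by rewrite rmorph_prod.
rewrite -rmorphXn; apply/fiber_pi_eq0; move: irr; congr (irrelevant I).
apply: val_inj; rewrite to_reesK; last first.
  by apply: in_rees_mono; apply: ideal_exp_leq Ia.
rewrite -aM rmorphXn rmorph_prod; congr (_ ^+ _); apply: eq_bigr => j _.
by rewrite /r /= to_reesK //; apply: rees_deg1_mem; apply: gen_mem.
Qed.

(** * Minimal primes of the fiber ring and of its presentation *)

Lemma zero_ideal (A : comNzRingType) : is_ideal [set 0 : A].
Proof. by split=> [//|x y -> ->|c x ->]; rewrite ?addr0 ?mulr0. Qed.

Section Presentation.
Variables (k : fieldType) (n : nat) (J : set {mpoly k[n]}).
Variables (m : nat) (a : 'I_m -> 'X_{1..n}).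

Definition to_reducedr (A : comNzRingType) : {rmorphism A -> reduced A} :=
  \pi_{ideal_quot (in_nilradical (A := A))}.

Lemma presentationE f : presentation J m a f = to_reduced (fiber_pres J a f).
Proof.
rewrite -[RHS]/(to_reducedr (fiber J) _) rmorph_sum; apply: eq_bigr => b _.
rewrite rmorphM; congr (_ * _); rewrite rmorph_prod; apply: eq_bigr => i _.
by rewrite rmorphXn.
Qed.

Lemma presentation_eq0 f :
  presentation J m a f = 0 <-> exists N, fiber_pres J a f ^+ N = 0.
Proof. by rewrite presentationE to_reduced_eq0. Qed.

Lemma presentation_prime (p : set (fiber J)) : prime_ideal p ->
  presentation J m a @^-1` (@to_reduced _ @` p) = fiber_pres J a @^-1` p.
Proof.
move=> pp; apply/seteqP; split=> f; rewrite /preimage /mkset presentationE.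
  by move/(to_reduced_prime _ pp).
by move=> pf; apply/(to_reduced_prime _ pp).
Qed.

Lemma presentation_ker_ideal : is_ideal [set f | presentation J m a f = 0].
Proof.
rewrite (_ : [set f | _] = (to_reducedr _ \o fiber_pres J a) @^-1` [set 0]).
  exact: preimage_ideal (zero_ideal _).
by apply/funext => f; rewrite /= presentationE.
Qed.

End Presentation.

Section MinimalPrimes.
Variables (k : fieldType) (n : nat) (I : set {mpoly k[n]}).
Hypotheses (I_monomial : monomial_ideal I) (I_neq0 : I <> [set 0]).
Hypothesis I_proper : I <> setT.
Local Notation g := (fiber_pres I (gen I)).
Local Notation gv v := (fiber_pres (min_part I v) (min_gen I v)).
Implicit Type v : {fraction {poly {mpoly k[n]}}} -> int.

(** All that the final arguments use of a Rees valuation: [P_il] is the preimage of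
    [p_il] under a retraction compatible with the presentations. *)
Lemma fiber_retraction v : rees_valuation I v ->
  exists psi : {rmorphism fiber I -> fiber (min_part I v)},
  [/\ forall p, is_ideal p -> lift_prime I v p = psi @^-1` p,
      forall P, prime_ideal P -> outer_gens I v `<=` P ->
        exists2 p, prime_ideal p & P = psi @^-1` p
    & forall f, psi (g f) = gv v (var_proj k (min_gens I v) f)].
Proof.
move=> Iv; have [psi [embK psi_out retr psiC psi_min]] :=
  exists_fiber_retraction I_monomial I_neq0 Iv.
have psi_outer x : outer_ideal I v x -> psi x = 0.
  by apply: (ideal_gen_min (preimage_ideal psi (zero_ideal _))).
exists psi; split=> [p idp|P pP outP|f].
- apply: (ideal_gen_retract embK psi_outer _ idp) => z.
  exact: sub_ideal_gen (retr z).
- have [pp eP] := retract_prime embK retr pP outP.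
  by exists (fiber_incl (min_part I v) I @^-1` P).
apply: (mpoly_rmorph_eq (f := psi \o g) (g := gv v \o var_proj k (min_gens I v))).
  move=> c; rewrite -[LHS]/(psi (g c%:MP)) -[RHS]/(gv v (var_proj k _ c%:MP)).
  by rewrite var_projC !fiber_presC.
move=> j; rewrite -[LHS]/(psi (g 'X_j)) -[RHS]/(gv v (var_proj k _ 'X_j)) fiber_presX.
have [jmin|jout] := boolP (j \in min_gens I v).
  rewrite psi_min // -{2}(enum_rankK_in jmin jmin) var_projX fiber_presX.
  by rewrite /min_gen enum_rankK_in.
by rewrite (var_proj_out _ jout) rmorph0; apply: psi_out; exists j.
Qed.

Lemma extend_YE v a : is_ideal a ->
  extend_Y I v a = var_proj k (min_gens I v) @^-1` a.
Proof.
exact: (ideal_gen_retract (@var_embK k _ _) (@outer_vars_proj k _ _)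
  (@var_proj_retract k _ _)).
Qed.

Lemma lift_prime_prime v p : rees_valuation I v -> prime_ideal p ->
  prime_ideal (lift_prime I v p).
Proof.
move=> Iv pp; have [psi [liftE _ _]] := fiber_retraction Iv.
by rewrite liftE; [exact: preimage_prime|case: pp].
Qed.

Lemma lifted_primes_prime P : lifted_primes I P -> prime_ideal P.
Proof.
by move=> [v [p [Iv /minimal_prime_prime pp ->]]]; apply: lift_prime_prime.
Qed.

Lemma prime_contains_lifted P : prime_ideal P ->
  exists2 Q, lifted_primes I Q & Q `<=` P.
Proof.
move=> pP; have [v Iv outP] := prime_contains_outer I_monomial I_neq0 I_proper pP.
have [psi [liftE primeE _]] := fiber_retraction Iv.
have [p pp eP] := primeE _ pP outP; have [q mq qp] := exists_minimal_prime pp.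
exists (lift_prime I v q); first by exists v, q.
by rewrite liftE ?eP; [move=> z /qp|case: (minimal_prime_prime mq)].
Qed.

(** Both sides follow from the fact that every prime contains a lifted prime and
    that lifted primes are prime. *)
Lemma minimal_primes_fiber :
  minimal_primes [set 0 : fiber I] = minimal_elements (lifted_primes I).
Proof.
apply/seteqP; split=> P.
  move=> mP; have [Q lQ QP] := prime_contains_lifted (minimal_prime_prime mP).
  have eQ := minimal_prime_eq mP (lifted_primes_prime lQ) QP.
  rewrite -{1}eQ; split=> // N lN; rewrite eQ.
  exact: minimal_prime_eq mP (lifted_primes_prime lN).
move=> [lP minP]; split.
  split; first exact: lifted_primes_prime.
  by move=> _ ->; case: (lifted_primes_prime lP) => -[].
move=> N [pN _] NP; have [Q lQ QN] := prime_contains_lifted pN.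
have eQ := minP _ lQ (subset_trans QN NP).
by apply/seteqP; split=> //; rewrite -eQ.
Qed.

(** An element lying in all lifted primes lies in all primes, so it is
    nilpotent. *)
Lemma pres_ker_lifted : pres_ker I = \bigcap_(v in rees_valuation I)
  \bigcap_(p in minimal_primes [set 0 : fiber (min_part I v)])
    (g @^-1` lift_prime I v p).
Proof.
apply/seteqP; split=> f.
  move=> /presentation_eq0[N fN] v Iv p /minimal_prime_prime pp.
  exact: prime_ideal_nilpotent (lift_prime_prime Iv pp) fN.
move=> fl; apply/presentation_eq0/nilpotent_of_primes => P.
move=> /prime_contains_lifted[_ [v [p [Iv mp ->]]]]; apply.
exact: fl.
Qed.

Lemma extend_Y_preim v p : rees_valuation I v -> prime_ideal p ->
  extend_Y I v (pres_preim_at I v p) = g @^-1` lift_prime I v p.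
Proof.
move=> Iv pp; have [psi [liftE _ psig]] := fiber_retraction Iv.
rewrite liftE; last by case: pp.
rewrite /pres_preim_at presentation_prime // extend_YE; last first.
  by apply: preimage_ideal; case: pp.
by apply/seteqP; split=> f; rewrite /= psig.
Qed.

Lemma extend_Y_ker v : rees_valuation I v ->
  extend_Y I v (pres_ker_at I v) =
  \bigcap_(p in minimal_primes [set 0 : fiber (min_part I v)])
    (g @^-1` lift_prime I v p).
Proof.
move=> Iv; have [psi [liftE _ psig]] := fiber_retraction Iv.
rewrite extend_YE; last exact: presentation_ker_ideal.
apply/seteqP; split=> f.
  move=> /presentation_eq0[N fN] p /minimal_prime_prime pp.
  rewrite /= liftE; last by case: pp.
  have {}fN : psi (g f) ^+ N = 0 by rewrite psig.
  exact: prime_ideal_nilpotent pp fN.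
move=> fl; apply/presentation_eq0/nilpotent_of_minimal_primes => p mp.
rewrite -psig; have := fl p mp; rewrite /= liftE //.
by case: (minimal_prime_prime mp).
Qed.

End MinimalPrimes.

Theorem theorem6p8 (k : fieldType) (n : nat) (I : set {mpoly k[n]})
    (I_monomial : monomial_ideal I) (I_neq0 : I <> [set 0])
    (I_proper : I <> setT) :
  minimal_primes [set 0 : fiber I] = minimal_elements (lifted_primes I)
  /\
  [/\ pres_ker I = \bigcap_(v in rees_valuation I) extend_Y I v (pres_ker_at I v),
      pres_ker I = \bigcap_(v in rees_valuation I)
        \bigcap_(p in minimal_primes [set 0 : fiber (min_part I v)])
          extend_Y I v (pres_preim_at I v p)
    & pres_ker I = \bigcap_(v in rees_valuation I)
        \bigcap_(p in minimal_primes [set 0 : fiber (min_part I v)])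
          pres_preim I (lift_prime I v p)].
Proof.
split; first exact: minimal_primes_fiber.
rewrite pres_ker_lifted //; split; apply: eq_bigcapr => v Iv.
- by rewrite extend_Y_ker.
- by apply: eq_bigcapr => p /minimal_prime_prime pp; rewrite extend_Y_preim.
apply: eq_bigcapr => p /minimal_prime_prime pp.
by rewrite /pres_preim presentation_prime //; apply: lift_prime_prime.
Qed.
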